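(* Let $(A,[\cdot,\cdot],a)$ be a transitive Lie algebroid over a smooth manifold $M$ and let $L=\ker(a)$. Then the cohomology of $A$ with coefficients in the adjoint representation $\mathrm{ad}$ of $A$ on $L$ is isomorphic to the deformation cohomology of $A$: $$\mathrm{H}^\bullet(A;\mathrm{ad})\cong\mathrm{H}^\bullet_{\mathrm{def}}(A).$$
   Context: A Lie algebroid $(A,[\cdot,\cdot],a)$ over $M$ is a vector bundle $A\to M$ with a Lie bracket on $\Gamma(A)$ and a bundle map (anchor) $a:A\to TM$ with $[X,fY]=f[X,Y]+a(X)(f)Y$. It is transitive if $a$ is surjective. In that case $L=\ker(a)$ is a bundle of Lie algebras and the adjoint representation of $A$ on $L$ is $\mathrm{ad}_uX=[u,X]$ for $u\in\Gamma(A)$, $X\in\Gamma(L)$. $\mathrm{H}^\bullet(A;\mathrm{ad})$ is the cohomology of the complex $(\Gamma(\mathrm{Hom}(\wedge^\bullet A,L)),\mathrm{d}_A)$, where $\mathrm{d}_A$ is the usual Lie algebroid (Chevalley–Eilenberg) coboundary with coefficients in this representation. Deformation cohomology: $C^n_{\mathrm{def}}(A)$ consists of the skew-symmetric $\mathbb{R}$-multilinear maps $D:\Gamma(A)^n\to\Gamma(A)$ that are multiderivations, i.e. there is $\sigma_D\in\Gamma(\mathrm{Hom}(\wedge^{n-1}A,TM))$ (the symbol) with $D(u_1,\dots,fu_n)=fD(u_1,\dots,u_n)+\sigma_D(u_1,\dots,u_{n-1})(f)u_n$ for all $f\in C^\infty(M)$; $C^0_{\mathrm{def}}(A)=\Gamma(A)$.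 The coboundary is $$\delta(D)(u_0,\dots,u_n)=\sum_i(-1)^i[u_i,D(u_0,\dots,\widehat{u_i},\dots,u_n)]+\sum_{i<j}(-1)^{i+j}D([u_i,u_j],u_0,\dots,\widehat{u_i},\dots,\widehat{u_j},\dots,u_n),$$ and $\mathrm{H}^\bullet_{\mathrm{def}}(A)$ is the cohomology of $(C^\bullet_{\mathrm{def}}(A),\delta)$. *)

(* Defs.v *)
From HB Require Import structures.
From mathcomp Require Import ssreflect ssrfun ssrbool eqtype ssrnat seq choice.
From mathcomp Require Import fintype bigop order perm ssralg ssrnum matrix.
From mathcomp Require Import generic_quotient ring_quotient.
From mathcomp Require Import boolp classical_sets functions reals topology.
From mathcomp Require Import normedtype landau derive.
Import numFieldNormedType.Exports.

Set Implicit Arguments.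
Unset Strict Implicit.
Unset Printing Implicit Defensive.

Import Order.TTheory GRing.Theory Num.Theory.
Local Open Scope classical_set_scope.
Local Open Scope quotient_scope.
Local Open Scope ring_scope.

(** * Smooth maps between normed spaces *)

Section Smooth.
Variables (R : realType) (V : normedModType R).

(* Meant for [U] open. Iterated Frechet differentiability; continuity of each
   derivative follows from differentiability at the next order. *)
Fixpoint differentiable_upto (W : normedModType R) (k : nat) (U : set V)
    (f : V -> W) : Prop :=
  if k is k'.+1 then
    (forall x, U x -> differentiable f x) /\
    (forall v, differentiable_upto k' U ('D_v f))
  else True.

Definition smooth_on (W : normedModType R) (U : set V) (f : V -> W) : Prop :=
  forall k, differentiable_upto k U f.

Lemma near0_differentiable (W : normedModType R) (f : V -> W) x :
  (\forall y \near x, f y = 0) -> differentiable f x.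
Proof.
move=> f0; have fx0 : f x = 0 by exact: (nbhs_singleton f0).
have fo : f \o shift x = cst (f x) + (0 : V -> W) +o_ 0 id.
  apply/eqaddoP => e e0.
  move: f0; rewrite (near_shift 0) /= subr0 => f0.
  near=> y; rewrite !fctE fx0 /= add0r subr0.
  have -> : f (y + x) = 0 by near: y.
  by rewrite normr0 mulr_ge0 // ltW.
have d0 : 'd f x = 0 :> (V -> W).
  by apply/diff_unique => //; exact: cst_continuous.
by apply/diff_locallyP; rewrite d0; split => //; exact: cst_continuous.
Unshelve. all: by end_near. Qed.

Lemma near_eq_differentiable (W : normedModType R) (f g : V -> W) x :
  (\forall y \near x, f y = g y) -> differentiable f x -> differentiable g x.
Proof.
move=> fg df; have -> : g = f + (g - f) by rewrite addrC subrK.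
apply: differentiableD => //; apply: near0_differentiable.
by apply: filterS fg => y; rewrite !fctE => ->; rewrite subrr.
Qed.

Lemma eq_differentiable_upto (W : normedModType R) k (U : set V) (f g : V -> W) :
  open U -> {in U, f =1 g} ->
  differentiable_upto k U f -> differentiable_upto k U g.
Proof.
move=> Uo; elim: k f g => // k IH f g fg [df dDf].
have nfg x : U x -> \forall y \near x, f y = g y.
  move=> Ux; apply: filterS (open_nbhs_nbhs (conj Uo Ux)) => y Uy.
  by apply: fg; rewrite inE.
split=> [x Ux|v]; first exact: near_eq_differentiable (nfg x Ux) (df x Ux).
by apply: IH (dDf v) => x /set_mem Ux; apply: near_eq_derive; exact: nfg.
Qed.

Lemma differentiable_upto_cst (W : normedModType R) k (U : set V) (a : W) :
  differentiable_upto k U (cst a).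
Proof.
elim: k a => // k IH a; split=> [x _|v]; first exact: differentiable_cst.
have -> : 'D_v (cst a) = cst 0 :> (V -> W) by apply/funext => x; exact: derive_cst.
exact: IH.
Qed.

Lemma differentiable_uptoW (W : normedModType R) k (U : set V) (f : V -> W) :
  differentiable_upto k.+1 U f -> differentiable_upto k U f.
Proof.
elim: k f => // k IH f [df dDf]; split=> // v; exact: IH.
Qed.

Lemma differentiable_uptoD (W : normedModType R) k (U : set V) (f g : V -> W) :
  open U -> differentiable_upto k U f -> differentiable_upto k U g ->
  differentiable_upto k U (f + g).
Proof.
move=> Uo; elim: k f g => // k IH f g [df dDf] [dg dDg].
split=> [x Ux|v]; first by apply: differentiableD; [exact: df|exact: dg].
apply: eq_differentiable_upto (IH _ _ (dDf v) (dDg v)) => // x /set_mem Ux.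
by rewrite deriveD //; apply: diff_derivable; [exact: df|exact: dg].
Qed.

Lemma differentiable_uptoM k (U : set V) (f g : V -> R) :
  open U -> differentiable_upto k U (f : V -> R^o) ->
  differentiable_upto k U (g : V -> R^o) ->
  differentiable_upto k U (f * g : V -> R^o).
Proof.
move=> Uo; elim: k f g => // k IH f g fk gk.
have [df dDf] := fk; have [dg dDg] := gk.
split=> [x Ux|v]; first by apply: differentiableM; [exact: df|exact: dg].
have h : differentiable_upto k U (f * 'D_v g + g * 'D_v f : V -> R^o).
  apply: differentiable_uptoD => //.
    exact: IH (differentiable_uptoW fk) (dDg v).
  exact: IH (differentiable_uptoW gk) (dDf v).
apply: eq_differentiable_upto h => // x /set_mem Ux.
by rewrite deriveM; [|apply: diff_derivable; exact: df
                    |apply: diff_derivable; exact: dg].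
Qed.

End Smooth.

(** * Smooth manifolds *)

(* [atlas] indexes the charts of a smooth atlas, not necessarily maximal.
   [chart_inv c] is the inverse of the chart [chart c]; outside
   [chart c @` chart_dom c] its values are irrelevant. *)
Record manifold (R : realType) := Manifold {
  manifold_space :> topologicalType;
  dim : nat;
  atlas : Type;
  chart_dom : atlas -> set manifold_space;
  chart : atlas -> manifold_space -> 'rV[R]_dim;
  chart_inv : atlas -> 'rV[R]_dim -> manifold_space;
  manifold_hausdorff : hausdorff_space manifold_space;
  manifold_second_countable : @second_countable manifold_space;
  chart_cover : forall x, exists c, chart_dom c x;
  chart_dom_open : forall c, open (chart_dom c);
  chart_img_open : forall c, open (chart c @` chart_dom c);
  chartK : forall c x, chart_dom c x -> chart_inv c (chart c x) = x;
  chart_continuous : forall c x,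
    chart_dom c x -> {for x, continuous (chart c)};
  chart_inv_continuous : forall c y,
    (chart c @` chart_dom c) y -> {for y, continuous (chart_inv c)};
  chart_smooth : forall c c',
    smooth_on (chart c @` (chart_dom c `&` chart_dom c'))
              (chart c' \o chart_inv c) }.

Arguments chart_dom {R M} c : rename.
Arguments chart {R M} c x : rename.
Arguments chart_inv {R M} c y : rename.

Section Functions.
Variables (R : realType) (M : manifold R).

Definition smooth_fun_on (U : set M) (f : M -> R) : Prop :=
  forall c : atlas M,
    smooth_on (chart c @` (U `&` chart_dom c)) (f \o chart_inv c : _ -> R^o).

(* The algebra C^oo(M). *)
Definition smooth_fun := {f : M -> R | smooth_fun_on setT f}.

Definition smooth_fun_val (f : smooth_fun) : M -> R := proj1_sig f.
Coercion smooth_fun_val : smooth_fun >-> Funclass.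

(* The velocity at [x] of the straight line of direction [w] in the chart [c],
   as an operator on functions; w = e_i gives the i-th coordinate vector. *)
Definition chart_vector (c : atlas M) (x : M) (w : 'rV[R]_(dim M)) :
  smooth_fun -> R^o := fun f => 'D_w (f \o chart_inv c : _ -> R^o) (chart c x).

(* The tangent space T_x M, as a set of operators on C^oo(M). By the chain rule
   every chart around [x] gives the same operators. *)
Definition tangent (x : M) : set (smooth_fun -> R^o) :=
  [set v | exists c w, chart_dom c x /\ v = chart_vector c x w].

Lemma chart_img_openI (c : atlas M) (U : set M) :
  open U -> open (chart c @` (U `&` chart_dom c)).
Proof.
move=> Uo.
have -> : chart c @` (U `&` chart_dom c) =
          (chart c @` chart_dom c) `&` (chart_inv c @^-1` U).
  apply/seteqP; split=> [_ [x [Ux cx] <-]|y [[x cx <-]]] /=.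
    by split; [exists x|rewrite /= chartK].
  by rewrite chartK // => Ux; exists x.
rewrite openE => y [cy Uy]; rewrite /interior.
apply: filterI; first by apply: open_nbhs_nbhs; split=> //; exact: chart_img_open.
by apply: (chart_inv_continuous cy); apply: open_nbhs_nbhs.
Qed.

Lemma smooth_fun_on_cst (U : set M) (a : R) : smooth_fun_on U (cst a).
Proof. by move=> c k; exact: differentiable_upto_cst. Qed.

Lemma smooth_fun_onD (U : set M) (f g : M -> R) : open U ->
  smooth_fun_on U f -> smooth_fun_on U g -> smooth_fun_on U (f + g).
Proof.
move=> Uo sf sg c k.
exact: (@differentiable_uptoD _ _ R^o k _ (f \o chart_inv c) (g \o chart_inv c)
          (chart_img_openI (c := c) Uo) (sf c k) (sg c k)).
Qed.

Lemma smooth_fun_onM (U : set M) (f g : M -> R) : open U ->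
  smooth_fun_on U f -> smooth_fun_on U g -> smooth_fun_on U (f * g).
Proof.
move=> Uo sf sg c k.
exact: (@differentiable_uptoM _ _ k _ (f \o chart_inv c) (g \o chart_inv c)
          (chart_img_openI (c := c) Uo) (sf c k) (sg c k)).
Qed.

Lemma smooth_fun_onS (U U' : set M) (f : M -> R) :
  U `<=` U' -> smooth_fun_on U' f -> smooth_fun_on U f.
Proof.
move=> UU' sf c k.
elim: k (f \o chart_inv c : _ -> R^o) (sf c k) => //= k IH g [dg dDg].
split=> [_ [x [Ux cx] <-]|v]; last exact: IH.
by apply: dg; exists x => //; split => //; exact: UU'.
Qed.

Lemma smooth_fun_differentiable (f : smooth_fun) c (x : M) : chart_dom c x ->
  differentiable (f \o chart_inv c : _ -> R^o) (chart c x).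
Proof. by move=> cx; have [+ _] := proj2_sig f c 1; apply; exists x. Qed.

Lemma chart_vectorE c x w (f : smooth_fun) : chart_dom c x ->
  chart_vector c x w f = 'd (f \o chart_inv c : _ -> R^o) (chart c x) w.
Proof. by move=> cx; rewrite /chart_vector deriveE //; exact: smooth_fun_differentiable. Qed.

Lemma chart_vectorP c x a w w' : chart_dom c x ->
  chart_vector c x (a *: w + w') = a *: chart_vector c x w + chart_vector c x w'.
Proof.
move=> cx; apply/funext => f.
rewrite -[RHS]/(a *: chart_vector c x w f + chart_vector c x w' f).
by rewrite !chart_vectorE // linearP.
Qed.

Lemma chart_vector_change c c' (x : M) w : chart_dom c x -> chart_dom c' x ->
  chart_vector c' x w =
  chart_vector c x ('d (chart c \o chart_inv c') (chart c' x) w).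
Proof.
move=> cx c'x; apply/funext => f; rewrite [RHS]chart_vectorE //.
set tau := chart c \o chart_inv c'; set p := chart c' x.
have taup : tau p = chart c x by rewrite /tau /p /= chartK.
have dtau : differentiable tau p.
  by have [+ _] := chart_smooth c' c 1; apply; exists x.
have df : differentiable (f \o chart_inv c : _ -> R^o) (tau p).
  by rewrite taup; exact: smooth_fun_differentiable.
rewrite -taup -[RHS]/(('d (f \o chart_inv c : _ -> R^o) (tau p) \o 'd tau p) w).
rewrite -diff_comp // -deriveE; last exact: differentiable_comp.
apply: near_eq_derive; near=> y.
have [z [c'z cz] <-] : (chart c' @` (chart_dom c `&` chart_dom c')) y.
  near: y; apply: open_nbhs_nbhs; split; last by exists x.
  exact/chart_img_openI/chart_dom_open.
by rewrite /tau /= chartK // chartK.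
Unshelve. all: by end_near. Qed.

Lemma tangentP (x : M) a v v' :
  tangent x v -> tangent x v' -> tangent x (a *: v + v').
Proof.
move=> [c [w [cx ->]]] [c' [w' [c'x ->]]]; rewrite (chart_vector_change w' cx c'x).
by exists c; eexists; split; [exact: cx|rewrite -chart_vectorP].
Qed.

Lemma tangent0 (x : M) : tangent x 0.
Proof.
have [c cx] := chart_cover x; exists c, 0; split => //.
by apply/funext => f; rewrite chart_vectorE // linear0.
Qed.

End Functions.

(** * Vector bundles *)

(* A vector bundle is given by its fibres and a cover by local trivializations
   with smooth transition maps, which determine the total space. [triv t] is
   only required to be an isomorphism over [triv_dom t]. *)
Record vector_bundle (R : realType) (M : manifold R) := VectorBundle {
  fiber :> M -> lmodType R;
  triv_index : Type;
  triv_dom : triv_index -> set M;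
  rank : triv_index -> nat;
  triv : forall t x, {linear fiber x -> 'rV[R]_(rank t)};
  triv_inv : forall t x, 'rV[R]_(rank t) -> fiber x;
  triv_cover : forall x, exists t, triv_dom t x;
  triv_dom_open : forall t, open (triv_dom t);
  trivK : forall t x, triv_dom t x -> cancel (@triv t x) (@triv_inv t x);
  triv_invK : forall t x, triv_dom t x -> cancel (@triv_inv t x) (@triv t x);
  triv_smooth : forall t t' (e : 'rV[R]_(rank t)) (i : 'I_(rank t')),
    smooth_fun_on (triv_dom t `&` triv_dom t')
      (fun x => @triv t' x (@triv_inv t x e) ord0 i) }.

Arguments triv_dom {R M A} t : rename.
Arguments rank {R M A} t : rename.
Arguments triv {R M A} t x : rename.
Arguments triv_inv {R M A} t x e : rename.

Section Family.
Variables (R : realType) (T : Type) (E : T -> lmodType R).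

Definition family := forall x, E x.

HB.instance Definition _ := Choice.on family.

Implicit Types u v w : family.

Definition family0 : family := fun=> 0.
Definition familyN u : family := fun x => - u x.
Definition familyD u v : family := fun x => u x + v x.
Definition familyZ (a : R) u : family := fun x => a *: u x.

Lemma familyDA : associative familyD.
Proof. by move=> u v w; apply/functional_extensionality_dep => x; exact: addrA. Qed.
Lemma familyDC : commutative familyD.
Proof. by move=> u v; apply/functional_extensionality_dep => x; exact: addrC. Qed.
Lemma family0D : left_id family0 familyD.
Proof. by move=> u; apply/functional_extensionality_dep => x; exact: add0r. Qed.
Lemma familyND : left_inverse family0 familyN familyD.
Proof. by move=> u; apply/functional_extensionality_dep => x; exact: addNr. Qed.

HB.instance Definition _ :=
  GRing.isZmodule.Build family familyDA familyDC family0D familyND.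

Lemma familyZA a b u : familyZ a (familyZ b u) = familyZ (a * b) u.
Proof. by apply/functional_extensionality_dep => x; exact: scalerA. Qed.
Lemma family1Z : left_id 1 familyZ.
Proof. by move=> u; apply/functional_extensionality_dep => x; exact: scale1r. Qed.
Lemma familyZDr : right_distributive familyZ +%R.
Proof. by move=> a u v; apply/functional_extensionality_dep => x; exact: scalerDr. Qed.
Lemma familyZDl u : {morph familyZ^~ u : a b / a + b}.
Proof. by move=> a b; apply/functional_extensionality_dep => x; exact: scalerDl. Qed.

HB.instance Definition _ :=
  GRing.Zmodule_isLmodule.Build R family familyZA family1Z familyZDr familyZDl.

End Family.

Section Sections.
Variables (R : realType) (M : manifold R) (A : vector_bundle M).

Definition smooth_section (u : family A) : Prop :=
  forall (t : triv_index A) (i : 'I_(rank t)),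
    smooth_fun_on (triv_dom t) (fun x => triv t x (u x) ord0 i).

Definition smooth_section_pred : pred (family A) := fun u => `[< smooth_section u >].

Lemma smooth_section_submod : submod_closed smooth_section_pred.
Proof.
split=> [|a u v /asboolP su /asboolP sv]; apply/asboolP => t i.
  have -> : (fun x => triv t x ((0 : family A) x) ord0 i) = cst 0.
    by apply/funext => x; rewrite linear0 mxE.
  exact: smooth_fun_on_cst.
have -> : (fun x => triv t x ((a *: u + v : family A) x) ord0 i) =
    cst a * (fun x => triv t x (u x) ord0 i) + (fun x => triv t x (v x) ord0 i).
  by apply/funext => x; rewrite linearP !mxE.
have to := triv_dom_open t.
by apply: smooth_fun_onD => //; apply: smooth_fun_onM => //; exact: smooth_fun_on_cst.
Qed.

HB.instance Definition _ := GRing.isSubmodClosed.Build R (family A)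
  smooth_section_pred smooth_section_submod.

(* The space of smooth sections, Gamma(A), as a real vector space. *)
Record sections := Section {
  section_val : family A;
  section_smooth : smooth_section_pred section_val }.

HB.instance Definition _ := [isSub for section_val].
HB.instance Definition _ := [Choice of sections by <:].
HB.instance Definition _ := [SubChoice_isSubLmodule of sections by <:].

Definition section_eval (u : sections) : forall x, A x := section_val u.
Coercion section_eval : sections >-> Funclass.

Lemma section_scale_subproof (f : smooth_fun M) (u : sections) :
  smooth_section_pred (fun x => f x *: u x).
Proof.
apply/asboolP => t i.
have -> : (fun x => triv t x (f x *: u x) ord0 i) =
    (f : M -> R) * (fun x => triv t x (u x) ord0 i).
  by apply/funext => x; rewrite linearZ mxE.
apply: smooth_fun_onM; first exact: triv_dom_open.
  exact: smooth_fun_onS (proj2_sig f).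
by have /asboolP := section_smooth u; apply.
Qed.

Definition section_scale (f : smooth_fun M) (u : sections) : sections :=
  Section (section_scale_subproof f u).

End Sections.

Arguments sections {R M} A.

(** * Quotients of modules, and cohomology of complexes *)

Section LmodQuotient.
Variables (K : pzRingType) (V : lmodType K) (B : submodClosed V).

Definition submod_pred : pred V := fun v => v \in B.

Lemma submod_zmod_closed : zmod_closed submod_pred.
Proof.
split=> [|u v Bu Bv]; first exact: rpred0.
by apply: rpredD => //; rewrite -scaleN1r; exact: rpredZ.
Qed.

HB.instance Definition _ := GRing.isZmodClosed.Build V
  submod_pred submod_zmod_closed.

Definition submod_zmod : zmodClosed V := GRing.ZmodClosed.clone V submod_pred _.

(* The quotient module V / B. *)
Definition lmod_quot := Quotient.quot submod_zmod.

HB.instance Definition _ := GRing.Zmodule.on lmod_quot.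

Definition lmod_quot_scale (a : K) (x : lmod_quot) : lmod_quot :=
  \pi (a *: repr x).

Lemma pi_lmod_scale a (v : V) :
  lmod_quot_scale a (\pi v) = \pi (a *: v) :> lmod_quot.
Proof.
have Bv : repr (\pi_lmod_quot v) - v \in B.
  rewrite -[_ \in B]/(_ \in submod_zmod).
  by rewrite Quotient.idealrBE reprK.
apply/eqP; rewrite -Quotient.idealrBE -scalerBr.
by rewrite -[_ \in submod_zmod]/(_ \in B); apply: rpredZ.
Qed.

Lemma pi_lmodD (u v : V) :
  (\pi_lmod_quot u : lmod_quot) + \pi_lmod_quot v = \pi (u + v).
Proof. exact: esym (Quotient.pi_add submod_zmod u v). Qed.

Lemma lmod_quot_scaleA a b x :
  lmod_quot_scale a (lmod_quot_scale b x) = lmod_quot_scale (a * b) x.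
Proof.
rewrite -[x]reprK (pi_lmod_scale b (repr x)).
by rewrite (pi_lmod_scale a (b *: _)) (pi_lmod_scale (a * b) (repr x)) scalerA.
Qed.

Lemma lmod_quot_scale1 : left_id 1 lmod_quot_scale.
Proof. by move=> x; rewrite -[x]reprK (pi_lmod_scale 1 (repr x)) scale1r. Qed.

Lemma lmod_quot_scaleDr : right_distributive lmod_quot_scale +%R.
Proof.
move=> a x y; rewrite -[x]reprK -[y]reprK (pi_lmodD (repr x)).
rewrite (pi_lmod_scale a (repr x + repr y)) (pi_lmod_scale a (repr x)).
by rewrite (pi_lmod_scale a (repr y)) pi_lmodD scalerDr.
Qed.

Lemma lmod_quot_scaleDl x : {morph lmod_quot_scale^~ x : a b / a + b}.
Proof.
move=> a b; rewrite -[x]reprK (pi_lmod_scale (a + b) (repr x)).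
rewrite (pi_lmod_scale a (repr x)) (pi_lmod_scale b (repr x)).
by rewrite pi_lmodD scalerDl.
Qed.

HB.instance Definition _ := GRing.Zmodule_isLmodule.Build K lmod_quot
  lmod_quot_scaleA lmod_quot_scale1 lmod_quot_scaleDr lmod_quot_scaleDl.

End LmodQuotient.

Section Cohomology.
Variables (R : realType) (V : nat -> lmodType R).
Variables (C : forall n, submodClosed (V n)).
Variables (d : forall n, {linear V n -> V n.+1}).

Definition is_cocycle n : pred (V n) := fun v => (v \in C n) && (d n v == 0).

Lemma is_cocycle_submod n : submod_closed (@is_cocycle n).
Proof.
split=> [|a u v /andP[Cu /eqP du] /andP[Cv /eqP dv]]; apply/andP.
  by rewrite rpred0 linear0.
by rewrite linearP du dv scaler0 addr0 rpredD ?rpredZ.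
Qed.

HB.instance Definition _ n := GRing.isSubmodClosed.Build R (V n)
  (@is_cocycle n) (@is_cocycle_submod n).

Record cocycles n := Cocycle {
  cocycle_val : V n;
  cocycle_proof : is_cocycle cocycle_val }.

HB.instance Definition _ n := [isSub for @cocycle_val n].
HB.instance Definition _ n := [Choice of cocycles n by <:].
HB.instance Definition _ n := [SubChoice_isSubLmodule of cocycles n by <:].

Definition is_coboundary n : pred (cocycles n) :=
  match n with
  | 0 => fun z => z == 0
  | m.+1 => fun z => `[< exists2 w, w \in C m & d m w = cocycle_val z >]
  end.

Lemma is_coboundary_submod n : submod_closed (@is_coboundary n).
Proof.
case: n => [|n]; split=> //.
- exact: eqxx.
- by move=> a u v /eqP -> /eqP ->; apply/eqP; rewrite scaler0 addr0.
- by apply/asboolP; exists 0; rewrite ?rpred0 ?linear0.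
- move=> a u v /asboolP[w Cw dw] /asboolP[w' Cw' dw']; apply/asboolP.
  by exists (a *: w + w'); rewrite ?rpredD ?rpredZ // linearP dw dw'.
Qed.

HB.instance Definition _ n := GRing.isSubmodClosed.Build R (cocycles n)
  (@is_coboundary n) (@is_coboundary_submod n).

Definition coboundaries n : submodClosed (cocycles n) :=
  GRing.SubmodClosed.clone R (cocycles n) (@is_coboundary n) _.

(* The n-th cohomology space of (C, d). The maps [d n] are defined on all of
   [V n], which contains C^n; a coboundary is an element d w, w in C^(n-1), that
   is a cocycle, so d (C^n) <= C^(n+1) and d o d = 0 are not needed to form the
   quotient. *)
Definition cohomology n := lmod_quot (coboundaries n).

HB.instance Definition _ n := GRing.Lmodule.on (cohomology n).

End Cohomology.

(** * Lie algebroids *)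

(* Bundle maps A -> TM over the identity, smooth in the sense that they send
   smooth sections to vector fields acting on C^oo(M). *)
Record tangent_map (R : realType) (M : manifold R) (A : vector_bundle M) :=
  TangentMap {
  tangent_map_val :> forall x, {linear A x -> (smooth_fun M -> R^o)};
  tangent_map_tangent : forall x e, tangent x (tangent_map_val x e);
  tangent_map_smooth : forall (u : sections A) (f : smooth_fun M),
    smooth_fun_on setT (fun x => tangent_map_val x (u x) f) }.

Record lie_algebroid (R : realType) (M : manifold R) := LieAlgebroid {
  lie_bundle :> vector_bundle M;
  anchor : tangent_map lie_bundle;
  bracket : sections lie_bundle -> sections lie_bundle -> sections lie_bundle;
  bracket_linear : forall u, linear (bracket u);
  bracket_skew : forall u v, bracket u v = - bracket v u;
  bracket_jacobi : forall u v w,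
    bracket u (bracket v w) + bracket v (bracket w u) + bracket w (bracket u v)
      = 0;
  bracket_leibniz : forall u (f : smooth_fun M) v x,
    bracket u (section_scale f v) x =
      f x *: bracket u v x + anchor x (u x) f *: v x }.

Definition is_transitive (R : realType) (M : manifold R) (A : lie_algebroid M) :=
  forall x (v : smooth_fun M -> R^o),
    tangent x v -> exists e, anchor A x e = v.

(** * Skew-symmetric multilinear maps *)

Lemma fct_linE (T : Type) (R : pzRingType) (W : lmodType R) (a : R)
  (f g : T -> W) x : (a *: f + g) x = a *: f x + g x.
Proof. by []. Qed.

Section Alternating.
Variables (R : realType) (E W : lmodType R).

Definition multilinear n (D : ('I_n -> E) -> W) : Prop :=
  forall (i : 'I_n) (u : 'I_n -> E) (a : R) (e e' : E),
    D [eta u with i |-> a *: e + e'] =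
      a *: D [eta u with i |-> e] + D [eta u with i |-> e'].

Definition skew n (D : ('I_n -> E) -> W) : Prop :=
  forall (s : 'S_n) (u : 'I_n -> E), D (u \o s) = (-1) ^+ s *: D u.

Definition alternating n (D : ('I_n -> E) -> W) : Prop :=
  multilinear D /\ skew D.

Lemma alternating0 n : alternating (0 : ('I_n -> E) -> W).
Proof. by split=> [i u a e e'|s u]; rewrite /GRing.zero /= ?scaler0 ?addr0. Qed.

Lemma alternatingP n a (D D' : ('I_n -> E) -> W) :
  alternating D -> alternating D' -> alternating (a *: D + D').
Proof.
move=> [mD sD] [mD' sD']; split=> [i u b e e'|s u]; rewrite !fct_linE.
  rewrite mD mD' !scalerDr !scalerA (mulrC a b) -!addrA; congr (_ + _).
  by rewrite addrCA.
by rewrite sD sD' scalerDr !scalerA (mulrC a).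
Qed.

End Alternating.

(** * Cohomology with adjoint coefficients and deformation cohomology *)

Section Cochains.
Variables (R : realType) (M : manifold R) (A : lie_algebroid M).

(* The ambient space of both complexes; a 0-cochain amounts to a section. *)
Definition cochain n := ('I_n -> sections A) -> sections A.

HB.instance Definition _ n := GRing.Lmodule.on (cochain n).

(* D is induced by a section of Hom(/\^n A, L), L = ker a: a family of maps
   (A_x)^n -> L_x, depending smoothly on x because D takes values in smooth
   sections. *)
Definition ad_cochain n (D : cochain n) : Prop :=
  exists om : forall x, ('I_n -> A x) -> A x,
    [/\ forall x, alternating (om x),
        forall x e, anchor A x (om x e) = 0 &
        forall u x, D u x = om x (fun i => u i x)].

(* Sections of Hom(/\^n A, TM), with smoothness tested on sections of A and
   functions on M. *)
Definition tangent_form n (sg : forall x, ('I_n -> A x) -> (smooth_fun M -> R^o))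
    : Prop :=
  [/\ forall x, alternating (sg x),
      forall x e, tangent x (sg x e) &
      forall (u : 'I_n -> sections A) (f : smooth_fun M),
        smooth_fun_on setT (fun x => sg x (fun i => u i x) f)].

(* The tuple (u_1, ..., u_n, v). *)
Definition snoc n T (u : 'I_n -> T) (v : T) : 'I_n.+1 -> T :=
  fun i => oapp u v (unlift ord_max i).

Definition has_symbol n (D : cochain n.+1)
    (sg : forall x, ('I_n -> A x) -> (smooth_fun M -> R^o)) : Prop :=
  forall (u : 'I_n -> sections A) (f : smooth_fun M) (v : sections A) x,
    D (snoc u (section_scale f v)) x =
      f x *: D (snoc u v) x + sg x (fun i => u i x) f *: v x.

Definition multiderivation n : cochain n -> Prop :=
  match n with
  | 0 => fun=> True
  | n'.+1 => fun D => exists2 sg, tangent_form (n := n') sg & has_symbol D sg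
  end.

Definition def_cochain n (D : cochain n) : Prop :=
  alternating D /\ multiderivation D.

(* The tuple ([u_i, u_j], u_0, ..., u_n) with u_i and u_j omitted, for i < j. *)
Definition contract n (u : 'I_n.+1 -> sections A) (i j : 'I_n.+1) :
    'I_n -> sections A :=
  fun k => if val k is k'.+1 then u (inord (bump j (bump i k')))
           else bracket (u i) (u j).

(* The coboundary of both complexes: on L-valued forms, ad_u X = [u, X]. *)
Definition delta n (D : cochain n) : cochain n.+1 := fun u =>
  \sum_(i < n.+1) (-1) ^+ i *: bracket (u i) (D (u \o lift i)) +
  \sum_(i < n.+1) \sum_(j < n.+1 | (i < j)%N)
    (-1) ^+ (i + j) *: D (contract u i j).

Lemma delta_linear n : linear (@delta n).
Proof.
move=> a D D'; apply/funext => u; rewrite fct_linE /delta.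
rewrite scalerDr addrACA !scaler_sumr; congr (_ + _).
  rewrite -big_split /=; apply: eq_bigr => i _.
  by rewrite fct_linE bracket_linear scalerDr !scalerA mulrC.
rewrite -big_split /=; apply: eq_bigr => i _; rewrite scaler_sumr -big_split /=.
by apply: eq_bigr => j _; rewrite fct_linE scalerDr !scalerA mulrC.
Qed.

HB.instance Definition _ n :=
  GRing.isLinear.Build R (cochain n) (cochain n.+1) _ (@delta n)
    (@delta_linear n).

Lemma section_eval0 x : (0 : sections A) x = 0.
Proof. by []. Qed.

Lemma section_evalP a (u v : sections A) x : (a *: u + v) x = a *: u x + v x.
Proof. by []. Qed.

Definition ad_cochain_pred n : pred (cochain n) := fun D => `[< ad_cochain D >].

Lemma ad_cochain_submod n : submod_closed (@ad_cochain_pred n).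
Proof.
split=> [|a D D' /asboolP[om [al an omE]] /asboolP[om' [al' an' omE']]].
  apply/asboolP; exists (fun x => 0); split=> // x *; first exact: alternating0.
  exact: linear0.
apply/asboolP; exists (fun x => a *: om x + om' x); split=> [x|x e|u x].
- exact: alternatingP.
- by rewrite fct_linE linearP an an' scaler0 addr0.
- by rewrite fct_linE section_evalP omE omE'.
Qed.

HB.instance Definition _ n := GRing.isSubmodClosed.Build R (cochain n)
  (@ad_cochain_pred n) (@ad_cochain_submod n).

Definition ad_cochains n : submodClosed (cochain n) :=
  GRing.SubmodClosed.clone R (cochain n) (@ad_cochain_pred n) _.

Definition def_cochain_pred n : pred (cochain n) := fun D => `[< def_cochain D >].

Lemma tangent_form0 n : tangent_form (n := n) (fun=> 0).
Proof.
split=> [x|x e|u f]; [exact: alternating0|exact: tangent0|].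
exact: smooth_fun_on_cst.
Qed.

Lemma tangent_formP n a sg sg' :
  tangent_form (n := n) sg -> tangent_form sg' ->
  tangent_form (fun x => a *: sg x + sg' x).
Proof.
move=> [al tg sm] [al' tg' sm']; split=> [x|x e|u f].
- exact: alternatingP.
- exact: tangentP.
- apply: (smooth_fun_onD openT _ (sm' u f)).
  by apply: (smooth_fun_onM openT _ (sm u f)); exact: smooth_fun_on_cst.
Qed.

Lemma def_cochain_submod n : submod_closed (@def_cochain_pred n).
Proof.
split=> [|a D D' /asboolP[al mD] /asboolP[al' mD']]; apply/asboolP.
  split; first exact: alternating0.
  case: n => //= n; exists (fun=> 0); first exact: tangent_form0.
  move=> u f v x; rewrite !section_eval0 scaler0 add0r.
  by rewrite [X in X *: _](_ : _ = 0) // scale0r.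
split; first exact: alternatingP.
case: n D D' {al al'} mD mD' => //= n D D' [sg tf sgE] [sg' tf' sgE'].
exists (fun x => a *: sg x + sg' x); first exact: tangent_formP.
move=> u f v x; rewrite fct_linE section_evalP sgE sgE'.
rewrite fct_linE section_evalP fct_linE.
rewrite -[X in _ = _ + X *: _]/(a * sg x (fun i => u i x) f +
  sg' x (fun i => u i x) f).
rewrite !scalerDr scalerDl !scalerA (mulrC a (f x)) -!addrA.
by congr (_ + _); rewrite addrCA.
Qed.

HB.instance Definition _ n := GRing.isSubmodClosed.Build R (cochain n)
  (@def_cochain_pred n) (@def_cochain_submod n).

Definition def_cochains n : submodClosed (cochain n) :=
  GRing.SubmodClosed.clone R (cochain n) (@def_cochain_pred n) _.

(* H^n(A; ad) *)
Definition ad_cohomology n := cohomology ad_cochains delta n.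

HB.instance Definition _ n := GRing.Lmodule.on (ad_cohomology n).

(* H^n_def(A) *)
Definition def_cohomology n := cohomology def_cochains delta n.

HB.instance Definition _ n := GRing.Lmodule.on (def_cohomology n).

End Cochains.

(* Main.v *)
Require Import Defs.
From HB Require Import structures.
From mathcomp Require Import ssreflect ssrfun ssrbool eqtype ssrnat seq.
From mathcomp Require Import fintype bigop order fingroup perm ssralg ssrnum.
From mathcomp Require Import interval matrix generic_quotient ring_quotient.
From mathcomp Require Import boolp classical_sets functions reals cardinality.
From mathcomp Require Import topology normedtype derive sequences realfun exp.
From mathcomp Require Import ring.
Import numFieldNormedType.Exports.

Set Implicit Arguments.
Unset Strict Implicit.
Unset Printing Implicit Defensive.

Import Order.TTheory GRing.Theory Num.Theory.
Local Open Scope classical_set_scope.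
Local Open Scope quotient_scope.
Local Open Scope ring_scope.

(** The isomorphism is induced by the inclusion of the forms with values in
    L = ker a into the deformation cochains. It is an isomorphism because the
    quotient complex is acyclic, by the following argument ([def_acyclicS]).

    Let D be a deformation cochain of degree n + 1 with symbol sigma. Since A is
    transitive, the anchor a has a smooth right inverse Lambda
    ([anchor_splitting]), and D' = (-1)^(n+1) Lambda sigma is an n-form with
    values in A. For such a form, delta D' is again a multiderivation, and its
    symbol is a D' up to sign ([delta_symbol]); hence D - delta D' has symbol
    zero, that is, it is a form with values in A. If delta D is a form as well, so
    is delta (D - delta D') = delta D. Its symbol is a (D - delta D') up to sign,
    so this vanishes and D - delta D' takes values in L ([ad_cochain_of_delta]).
    A diagram chase concludes ([cohomology_iso]).

    Three ingredients carry the argument.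

    The coboundary is the Chevalley-Eilenberg differential of the Lie algebra of
    sections with coefficients in itself. Cartan's formula
    i_x delta + delta i_x = L_x ([inner_delta]) determines it recursively; that it
    preserves alternating maps, commutes with L_x and squares to zero follows by
    induction on the degree, and the formula for the symbol by one more
    application.

    A cochain that is linear over functions is a bundle map
    ([tensorial_tensor_cochain]): a section vanishing at x is, up to bump
    functions, a combination of sections with coefficients vanishing at x. The
    bump functions come from exp(-1/x).

    The anchor splits locally, by inverting the matrix of the anchor in suitable
    sections and coordinates ([local_lifting]). Countably many local splittings
    cover M and are glued by the partition of unity
    phi_k (1 - phi_0) ... (1 - phi_(k-1)) ([glue_partial_liftings]). *)

(** * Iterated differentiability *)

Section DifferentiableUpto.
Variables (R : realType) (V : normedModType R).

(** Derivatives are those of the function on the whole space, so each clause of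
    the definition can be checked on any covering of the domain by sets. *)
Lemma differentiable_upto_local (W : normedModType R) k (U : set V) (f : V -> W) :
  (forall x, U x -> exists2 U' : set V, U' x & differentiable_upto k U' f) ->
  differentiable_upto k U f.
Proof.
elim: k f => // k IH f loc; split=> [x Ux|v].
  by have [U' U'x [df _]] := loc x Ux; exact: df.
by apply: IH => x /loc[U' U'x [_ dDf]]; exists U' => //; exact: dDf.
Qed.

Lemma differentiable_upto_coord n k (U : set V) (f : V -> 'rV[R]_n) i :
  open U -> differentiable_upto k U f ->
  differentiable_upto k U (fun x => f x ord0 i : R^o).
Proof.
move=> Uo; elim: k f => // k IH f [df dDf].
have dc x : U x -> differentiable (fun x => f x ord0 i : R^o) x.
  move=> Ux; apply: (@differentiable_comp _ _ _ _ f (fun M : 'rV[R]_n => M ord0 i : R^o)).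
    exact: df.
  exact: differentiable_coord.
split=> // v; apply: eq_differentiable_upto (IH _ (dDf v)) => // x /set_mem Ux.
by rewrite derive_mx ?mxE //; apply: diff_derivable; exact: df.
Qed.

Lemma derive_comp1 (g : R^o -> R^o) (h : V -> R^o) x v :
  differentiable h x -> differentiable g (h x) ->
  'D_v (g \o h) x = 'D_1 g (h x) * 'D_v h x.
Proof.
move=> dh dg; rewrite deriveE; last exact: differentiable_comp.
rewrite diff_comp //= -(deriveE _ dh).
rewrite -[X in 'd g (h x) X]mulr1 -[X in 'd g (h x) X]/('D_v h x *: (1 : R^o)).
by rewrite linearZ /= -deriveE // mulrC.
Qed.

Lemma differentiable_upto_comp k (U : set V) (g : R^o -> R^o) (h : V -> R^o) :
  open U -> (forall k, differentiable_upto k setT g) ->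
  differentiable_upto k U h -> differentiable_upto k U (g \o h).
Proof.
move=> Uo; elim: k g h => // k IH g h sg sh.
have dg y : differentiable g y by have [+ _] := sg 1; exact.
have [dh dDh] := sh; split=> [x Ux|v].
  by apply: differentiable_comp => //; exact: dh.
have H : differentiable_upto k U (('D_1 g \o h) * 'D_v h : V -> R^o).
  apply: differentiable_uptoM => //; last exact: dDh.
  apply: IH; last exact: differentiable_uptoW.
  by move=> j; have [_] := sg j.+1; exact.
apply: eq_differentiable_upto H => // x /set_mem Ux.
by rewrite derive_comp1 //; exact: dh.
Qed.

Lemma differentiable_uptoV k (U : set V) (h : V -> R^o) :
  open U -> (forall x, U x -> h x != 0) ->
  differentiable_upto k U h ->
  differentiable_upto k U (fun x => (h x)^-1 : R^o).
Proof.
move=> Uo h0; elim: k => // k IH sh.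
have [dh dDh] := sh; split=> [x Ux|v].
  exact: (@differentiableV _ _ h x (dh x Ux) (h0 x Ux)).
have H : differentiable_upto k U
    (cst (-1) * ((fun x => (h x)^-1) * (fun x => (h x)^-1)) * 'D_v h : V -> R^o).
  have iV := IH (differentiable_uptoW sh).
  apply: differentiable_uptoM => //; last exact: dDh.
  apply: differentiable_uptoM => //; first exact: differentiable_upto_cst.
  exact: differentiable_uptoM.
apply: eq_differentiable_upto H => // x /set_mem Ux.
rewrite (@deriveV _ _ h x v) ?h0 //; last by apply: diff_derivable; exact: dh.
rewrite -[LHS]/(-1 * ((h x)^-1 * (h x)^-1) * 'D_v h x) mulN1r.
by rewrite -[RHS]/(- (h x)^-2 * _) expr2 invfM.
Qed.

End DifferentiableUpto.

(** * Cut-off functions on the line *)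

Section Flat.
Variable R : realType.
Implicit Types x : R.

(** The functions x^-n exp(-1/x), extended by 0 to x <= 0. The whole family is
    treated at once because it is closed under differentiation up to linear
    combinations, whereas exp(-1/x) alone is not. *)
Definition flat n (x : R^o) : R^o :=
  if 0 < x then x^-1 ^+ n * expR (- x^-1) else 0.

Lemma flat_le0 n x : x <= 0 -> flat n x = 0.
Proof. by rewrite /flat ltNge => ->. Qed.

Lemma flat_gt0 n x : 0 < x -> 0 < flat n x.
Proof. by move=> x0; rewrite /flat x0 mulr_gt0 ?expR_gt0 ?exprn_gt0 ?invr_gt0. Qed.

(** With y = 1/x this is y^(n+2) exp(-y) <= (n+2)!, one term of the exponential
    series; the factor x^2 is what makes the derivative at 0 vanish. *)
Lemma flat_le n x : `|flat n x| <= (n.+2)`!%:R * x ^+ 2.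
Proof.
have [x0|x0] := leP x 0; first by rewrite flat_le0 // normr0 mulr_ge0 ?sqr_ge0.
rewrite ger0_norm; last by rewrite ltW ?flat_gt0.
rewrite /flat x0; set y := x^-1; have y0 : 0 < y by rewrite invr_gt0.
have -> : x ^+ 2 = (y ^+ 2)^-1 by rewrite exprVn invrK.
rewrite ler_pdivlMr ?exprn_gt0 // mulrAC -exprD addn2 expRN ler_pdivrMr ?expR_gt0 //.
rewrite mulrC -ler_pdivrMr ?ltr0n ?fact_gt0 //.
by apply: le_trans (expR_ge1Dxn n.+1 (ltW y0)); rewrite lerDr.
Qed.

Lemma is_derive_flat n x :
  is_derive (x : R^o) 1 (flat n) (flat n.+2 x - n%:R * flat n.+1 x).
Proof.
have [x0|x0|->] := ltgtP x 0.
- rewrite !flat_le0 ?ltW // mulr0 subr0.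
  apply: near_eq_is_derive (is_derive_cst (0 : R^o) x 1).
  near=> y; rewrite flat_le0 //.
  by apply/ltW; near: y; exact: lt_nbhsl.
- have h : is_derive (x : R^o) 1 (fun y : R^o => y^-1 ^+ n * expR (- y^-1) : R^o)
     (flat n.+2 x - n%:R * flat n.+1 x).
    have xn0 : x != 0 by rewrite gt_eqF.
    have dV : is_derive (x : R^o) 1 (fun y : R^o => y^-1 : R^o) (- x ^- 2).
      apply: is_derive_eq; first exact: (is_deriveV xn0 (is_derive_id x 1)).
      by rewrite /= [_ *: _]mulr1.
    have dE := @is_derive1_comp R expR (- (fun y : R => y^-1)) x _ _
      (is_derive_expR (- x^-1)) (is_deriveN dV).
    have -> : (fun y : R^o => y^-1 ^+ n * expR (- y^-1) : R^o) =
        (fun y : R^o => y^-1 : R^o) ^+ n * (expR \o - (fun y : R => y^-1)).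
      by apply/funext => y /=; rewrite !fctE.
    have dM := is_deriveM (is_deriveX n dV) dE.
    apply: (is_derive_eq dM).
    rewrite /flat x0 exprfctE /=.
    rewrite opprK -!exprVn -[(- _) x]/(- x^-1); move: (x^-1) (expR _) => y z.
    rewrite -![_ *: _]/(_ * _ : R).
    case: (n) => [|m] /=; rewrite !exprS ?expr0; ring.
  apply: near_eq_is_derive h => //.
  by near=> y; rewrite /flat ifT //; near: y; exact: lt_nbhsr.
rewrite !flat_le0 // mulr0 subr0.
have h : h^-1 *: (flat n (h *: (1 : R^o) + 0) - flat n 0) @[h --> 0^'] --> (0 : R^o).
  apply/cvgrPdist_le => /= e e0.
  near=> h.
  rewrite sub0r normrN.
  rewrite (flat_le0 n (lexx 0)) subr0 addr0 [h%:A]mulr1 normrZ normfV.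
  have h0 : h != 0 by near: h; exact: nbhs_dnbhs_neq.
  rewrite ler_pdivrMl ?normr_gt0 // (le_trans (flat_le _ _)) //.
  rewrite -real_normK ?num_real // expr2 mulrCA ler_pM2l ?normr_gt0 //.
  rewrite -ler_pdivlMl ?ltr0n ?fact_gt0 //.
  by near: h; apply: dnbhs0_le; rewrite mulr_gt0 ?invr_gt0 ?ltr0n ?fact_gt0.
apply: DeriveDef; first by apply/cvg_ex; exists 0.
exact: cvg_lim h.
Unshelve. all: by end_near.
Qed.

End Flat.

Section Cutoff.
Variable R : realType.

Lemma flat_smooth (k n : nat) : differentiable_upto k setT (flat n : R^o -> R^o).
Proof.
elim: k n => // k IH n; have dF (x : R^o) : differentiable (flat n : R^o -> R^o) x.
  by apply/derivable1_diffP; have [] := is_derive_flat n x.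
split=> // v.
have H : differentiable_upto k setT
    (cst v * (flat n.+2 + cst (- n%:R) * flat n.+1) : R^o -> R^o).
  apply: differentiable_uptoM; [exact: openT|exact: differentiable_upto_cst|].
  apply: differentiable_uptoD; [exact: openT|exact: IH|].
  by apply: differentiable_uptoM; [exact: openT|exact: differentiable_upto_cst|exact: IH].
apply: eq_differentiable_upto H; first exact: openT.
move=> x _; rewrite deriveE // -[v in RHS]mulr1 -[v * 1]/(v *: (1 : R^o)) linearZ /=.
rewrite -deriveE //; have [_ ->] := is_derive_flat n x.
by rewrite -[LHS]/(v * (flat n.+2 x + - n%:R * flat n.+1 x)) mulNr.
Qed.

Lemma flat0_homo (x y : R) : x <= y -> flat 0 x <= flat 0 y.
Proof.
move=> xy; have [x0|x0] := leP x 0.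
  rewrite flat_le0 //; have [y0|y0] := leP y 0; first by rewrite flat_le0.
  exact/ltW/flat_gt0.
have y0 := lt_le_trans x0 xy.
by rewrite /flat x0 y0 !expr0 !mul1r ler_expR lerN2 lef_pV2.
Qed.

(** With e = flat 0, the function 1 - e(t - a)/e(c - a) is 1 up to a, and is
    nonpositive from c on because e is nondecreasing; composing with e kills the
    nonpositive values, and dividing by the constant e(1) restores the value
    1. *)
Lemma cutoff_exists (a c : R) : a < c -> exists b : R^o -> R^o,
  [/\ forall k, differentiable_upto k setT b,
      forall t, t <= a -> b t = 1 & forall t, c <= t -> b t = 0].
Proof.
move=> ac; pose e : R^o -> R^o := flat 0.
have e1 : 0 < e 1 by exact: flat_gt0.
have eca : 0 < e (c - a) by rewrite flat_gt0 // subr_gt0.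
pose h1 : R^o -> R^o := id + cst (- a).
pose h2 : R^o -> R^o := cst 1 + cst (- (e (c - a))^-1) * (e \o h1).
have sid k : differentiable_upto k setT (id : R^o -> R^o).
  case: k => // k; split=> // v.
  rewrite (_ : 'D_v _ = cst v); first exact: differentiable_upto_cst.
  by apply/funext => x; rewrite derive_id.
have sh1 k : differentiable_upto k setT h1.
  by apply: differentiable_uptoD; [exact: openT|exact: sid|exact: differentiable_upto_cst].
have sh2 k : differentiable_upto k setT h2.
  apply: differentiable_uptoD; [exact: openT|exact: differentiable_upto_cst|].
  apply: differentiable_uptoM; [exact: openT|exact: differentiable_upto_cst|].
  by apply: differentiable_upto_comp => //; [exact: openT|move=> j; exact: flat_smooth].
exists (cst (e 1)^-1 * (e \o h2)); split=> [k|t ta|t ct].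
- apply: differentiable_uptoM; [exact: openT|exact: differentiable_upto_cst|].
  by apply: differentiable_upto_comp => //; [exact: openT|move=> j; exact: flat_smooth].
- rewrite -[LHS]/((e 1)^-1 * e (1 + - (e (c - a))^-1 * e (t - a))).
  by rewrite [e (t - a)]flat_le0 ?subr_le0 // mulr0 addr0 mulVf // gt_eqF.
rewrite -[LHS]/((e 1)^-1 * e (1 + - (e (c - a))^-1 * e (t - a))).
rewrite [e (1 + _)]flat_le0 ?mulr0 // mulNr subr_le0 ler_pdivlMl // mulr1.
by rewrite flat0_homo // lerD2r.
Qed.

End Cutoff.

(** * Smooth functions on a manifold *)

Section SmoothFunctions.
Variables (R : realType) (M : manifold R).
Implicit Types (U : set M) (f g : M -> R).

Lemma smooth_fun_on_local U f :
  (forall x, U x -> exists2 U', U' x & smooth_fun_on U' f) -> smooth_fun_on U f.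
Proof.
move=> loc c k; apply: differentiable_upto_local => _ [x [Ux cx] <-].
by have [U' U'x sf] := loc x Ux; exists (chart c @` (U' `&` chart_dom c)); [exists x|exact: sf].
Qed.

Lemma eq_smooth_fun_on U f g : open U -> (forall x, U x -> f x = g x) ->
  smooth_fun_on U f -> smooth_fun_on U g.
Proof.
move=> Uo fg sf c k; apply: eq_differentiable_upto (sf c k).
  exact: chart_img_openI.
by move=> _ /set_mem[x [Ux cx] <-]; rewrite /= chartK //; exact: fg.
Qed.

Lemma smooth_fun_on_comp U (b : R^o -> R^o) f : open U ->
  (forall k, differentiable_upto k setT b) -> smooth_fun_on U f ->
  smooth_fun_on U (b \o f).
Proof.
move=> Uo sb sf c k; apply: (@differentiable_upto_comp _ _ _ _ b (f \o chart_inv c)) => //.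
  exact: chart_img_openI.
exact: sf.
Qed.

Lemma smooth_fun_onV U f : open U -> (forall x, U x -> f x != 0) ->
  smooth_fun_on U f -> smooth_fun_on U (fun x => (f x)^-1).
Proof.
move=> Uo f0 sf c k; apply: (@differentiable_uptoV _ _ _ _ (f \o chart_inv c)).
- exact: chart_img_openI.
- by move=> _ [x [Ux cx] <-]; rewrite /= chartK //; exact: f0.
- exact: sf.
Qed.

Lemma smooth_fun_on_sum (I : finType) (P : pred I) U (F : I -> M -> R) : open U ->
  (forall i, P i -> smooth_fun_on U (F i)) ->
  smooth_fun_on U (fun x => \sum_(i | P i) F i x).
Proof.
move=> Uo sF; rewrite -fct_sumE.
elim/big_ind: _ => [|f g|//]; first exact: smooth_fun_on_cst.
exact: smooth_fun_onD.
Qed.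

Lemma smooth_fun_on_prod (I : finType) (P : pred I) U (F : I -> M -> R) : open U ->
  (forall i, P i -> smooth_fun_on U (F i)) ->
  smooth_fun_on U (fun x => \prod_(i | P i) F i x).
Proof.
move=> Uo sF; rewrite (_ : (fun x => _) = \prod_(i | P i) F i); last first.
  by apply/funext => x; elim/big_rec2: _ => // i a b _ ->.
elim/big_ind: _ => [|f g|//]; first exact: smooth_fun_on_cst.
exact: smooth_fun_onM.
Qed.

Lemma smooth_chart_coord (c : atlas M) i :
  smooth_fun_on (chart_dom c) (fun x => chart c x ord0 i).
Proof.
move=> c' k.
apply: (@differentiable_upto_coord _ _ _ _ _ (chart c \o chart_inv c')).
  exact/chart_img_openI/chart_dom_open.
by rewrite setIC; exact: chart_smooth.
Qed.

End SmoothFunctions.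

(** * Sections of a vector bundle *)

Section SectionEval.
Variables (R : realType) (M : manifold R) (A : vector_bundle M).
Implicit Types (x y : sections A) (f : smooth_fun M).

Lemma sectionP x y : (forall p, x p = y p) -> x = y.
Proof. by move=> xy; apply/val_inj/functional_extensionality_dep. Qed.

Lemma section_evalD x y p : (x + y) p = x p + y p.
Proof. by []. Qed.
Lemma section_evalN x p : (- x) p = - x p.
Proof. by []. Qed.
Lemma section_evalZ a x p : (a *: x) p = a *: x p.
Proof. by []. Qed.
Lemma section_eval_sum (I : finType) (P : pred I) (F : I -> sections A) p :
  (\sum_(i | P i) F i) p = \sum_(i | P i) F i p.
Proof. by elim/big_rec2: _ => [|i y z _ <-]. Qed.

Lemma section_scaleE f x p : section_scale f x p = f p *: x p.
Proof. by []. Qed.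

End SectionEval.

(** * Bump functions *)

Section Bumps.
Variables (R : realType) (M : manifold R).
Implicit Types (U V W K : set M) (x : M).

(** On a neighbourhood of a point of K both factors are smooth, and on the open
    complement of K the product is 0. *)
Lemma smooth_cut W U K (phi f : M -> R) : open W -> open U -> closed K ->
  K `<=` U -> (forall x, ~ K x -> phi x = 0) ->
  smooth_fun_on (U `&` W) phi -> smooth_fun_on (U `&` W) f ->
  smooth_fun_on W (phi * f).
Proof.
move=> Wo Uo Kc KU phi0 sphi sf; apply: smooth_fun_on_local => x Wx.
have [Kx|nKx] := pselect (K x).
  exists (U `&` W); first by split => //; exact: KU.
  by apply: smooth_fun_onM => //; exact: openI.
exists (~` K) => //; apply: (@eq_smooth_fun_on _ _ _ (cst 0)).
- exact: closed_openC.
- by move=> y nKy; rewrite -[RHS]/(phi y * f y) phi0 // mul0r.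
- exact: smooth_fun_on_cst.
Qed.

Lemma chart_cube_nbhs (c : atlas M) U x : open U -> U x -> chart_dom c x ->
  exists2 r : R, 0 < r & forall y : 'rV[R]_(dim M),
    (forall i, `|y ord0 i - chart c x ord0 i| <= r) ->
    (chart c @` (U `&` chart_dom c)) y.
Proof.
move=> Uo Ux cx; have Wo := chart_img_openI (c := c) Uo.
have : nbhs (chart c x) (chart c @` (U `&` chart_dom c)).
  by apply: open_nbhs_nbhs; split=> //; exists x.
move=> /nbhs_ballP[e /= e0 eW]; exists (e / 2); first exact: divr_gt0.
move=> y ye; apply: eW; split=> // i j; rewrite /ball /= !ord1 distrC.
by rewrite (le_lt_trans (ye j)) // ltr_pdivrMr // ltr_pMr // ltr1n.
Qed.

(** The bump is the product of one-variable cut-offs of the squared coordinates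
    centred at the point, extended by 0 outside the preimage K of a closed cube.
    K is compact, hence closed in M since M is Hausdorff; this gives the
    smoothness of the extension on the complement of K. *)
Lemma bump_exists U x : open U -> U x ->
  exists phi : smooth_fun M, exists K, exists V,
    [/\ closed K, K `<=` U & forall y, ~ K y -> phi y = 0] /\
    [/\ open V, V x & forall y, V y -> phi y = 1].
Proof.
move=> Uo Ux; have [c cx] := chart_cover x.
have [r r0 rW] := chart_cube_nbhs Uo Ux cx.
pose p := chart c x.
pose Q := [set y : 'rV[R]_(dim M) | forall i, y ord0 i \in `[p ord0 i - r, p ord0 i + r]].
have Q_W y : Q y -> (chart c @` (U `&` chart_dom c)) y.
  by move=> Qy; apply: rW => i; have := Qy i; rewrite in_itv /= ler_distl.
have Qc : compact Q.
  apply: (@rV_compact _ _ (fun i => `[p ord0 i - r, p ord0 i + r]%classic)) => i.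
  exact: segment_compact.
pose K := chart_inv c @` Q.
have KU y : K y -> U y /\ chart_dom c y.
  by move=> [z /Q_W[w [Uw cw] <-] <-]; rewrite chartK.
have Kc : closed K.
  apply: compact_closed; first exact: manifold_hausdorff.
  apply: continuous_compact Qc; apply: continuous_in_subspaceT => z /set_mem Qz.
  by have [w [_ cw] wz] := Q_W z Qz; apply: chart_inv_continuous; exists w.
have rr : (r / 2) ^+ 2 < r ^+ 2.
  rewrite ltr_pXn2r // ?nnegrE ?ltW ?divr_gt0 //.
  by rewrite ltr_pdivrMr // ltr_pMr // ltr1n.
have [b [sb b1 b0]] := cutoff_exists rr.
pose N y : R := \prod_i b ((chart c y ord0 i - p ord0 i) ^+ 2).
pose phi y : R := if `[< K y >] then N y else 0.
(* outside the cube some factor of the product already vanishes *)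
have phiN y : chart_dom c y -> phi y = N y.
  move=> cy; rewrite /phi; case: asboolP => // nKy.
  have /existsNP[i /negP Ni] : ~ Q (chart c y).
    by move=> Qy; apply: nKy; exists (chart c y) => //; rewrite chartK.
  rewrite /N (bigD1 i) //= b0 ?mul0r //.
  move: Ni; rewrite in_itv /= -ler_distl -ltNge => Ni.
  rewrite -[leRHS]real_normK ?num_real //.
  by apply: lerXn2r (ltW Ni); rewrite nnegrE ?normr_ge0 ?(ltW r0).
have sN : smooth_fun_on (chart_dom c) N.
  apply: smooth_fun_on_prod => [|i _]; first exact: chart_dom_open.
  apply: (smooth_fun_on_comp (b := b)) => //; first exact: chart_dom_open.
  have sd : smooth_fun_on (chart_dom c) ((fun y => chart c y ord0 i) + cst (- p ord0 i)).
    apply: smooth_fun_onD; first exact: chart_dom_open.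
      exact: smooth_chart_coord.
    exact: smooth_fun_on_cst.
  apply: (eq_smooth_fun_on _ _ (smooth_fun_onM _ sd sd)) => //;
    try exact: chart_dom_open.
have sphi : smooth_fun_on setT phi.
  apply: smooth_fun_on_local => y _; have [Ky|nKy] := pselect (K y).
    exists (chart_dom c); first by have [] := KU y Ky.
    apply: eq_smooth_fun_on sN => //; first exact: chart_dom_open.
    by move=> z /phiN.
  exists (~` K) => //; apply: (@eq_smooth_fun_on _ _ _ (cst 0)).
  - exact: closed_openC.
  - by move=> z nKz; rewrite /phi; case: asboolP.
  - exact: smooth_fun_on_cst.
have [V [Vo Vx Vb]] : exists V, [/\ open V, V x & V `<=`
    [set y | chart_dom c y /\ forall i, `|chart c y ord0 i - p ord0 i| <= r / 2]].
  have : nbhs x [set y | chart_dom c y /\ forall i, `|chart c y ord0 i - p ord0 i| <= r / 2].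
    near=> y; split; first by near: y; exact: open_nbhs_nbhs (conj (chart_dom_open c) cx).
    have : ball p (r / 2) (chart c y).
      by near: y; apply: (chart_continuous cx); apply: nbhsx_ballx; rewrite divr_gt0.
    by move=> [_ pr] i; rewrite distrC; apply/ltW/pr.
  by rewrite nbhsE => -[V [Vo Vx] Vsub]; exists V.
exists (exist _ phi sphi), K, V; split; split=> //.
- by move=> y /KU[].
- by move=> y nKy; rewrite /= /smooth_fun_val /= /phi; case: asboolP.
move=> y /Vb[cy yr]; rewrite /= /smooth_fun_val /= phiN // /N big1 // => i _.
rewrite b1 // -[leLHS]real_normK ?num_real //.
by apply: lerXn2r (yr i); rewrite nnegrE ?normr_ge0 ?divr_ge0 ?(ltW r0).
Unshelve. all: by end_near. Qed.

Lemma smooth_extension U (f : M -> R) x : open U -> U x -> smooth_fun_on U f ->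
  exists g : smooth_fun M, exists V,
    [/\ open V, V x, V `<=` U & forall y, V y -> g y = f y].
Proof.
move=> Uo Ux sf; have [phi [K [V [[Kc KU phi0] [Vo Vx phi1]]]]] := bump_exists Uo Ux.
have sg : smooth_fun_on setT ((phi : M -> R) * f).
  apply: (smooth_cut openT Uo Kc KU phi0); rewrite setIT //.
  exact: smooth_fun_onS (proj2_sig phi).
exists (exist _ _ sg), (U `&` V); split => //; first exact: openI.
by move=> y [_ /phi1 phiy]; rewrite -[LHS]/(phi y * f y) phiy mul1r.
Qed.

End Bumps.

(** * Extension of sections *)

Section LocalFrames.
Variables (R : realType) (M : manifold R) (A : vector_bundle M).

Lemma frame_section (t : triv_index A) (K : set M) (phi : smooth_fun M)
    (e : 'rV[R]_(rank t)) :
  closed K -> K `<=` triv_dom t -> (forall x, ~ K x -> phi x = 0) ->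
  exists s : sections A, forall x, s x = phi x *: triv_inv t x e.
Proof.
move=> Kc KU phi0; suff h : smooth_section_pred (fun x => phi x *: triv_inv t x e).
  by exists (Section h).
apply/asboolP => t' i.
rewrite (_ : (fun x => _) =
    (phi : M -> R) * (fun x => triv t' x (triv_inv t x e) ord0 i)); last first.
  by apply/funext => x; rewrite linearZ mxE.
apply: (smooth_cut _ _ Kc KU phi0); try exact: triv_dom_open.
  exact: smooth_fun_onS (proj2_sig phi).
exact: triv_smooth.
Qed.

Lemma section_through x (e : A x) : exists s : sections A, s x = e.
Proof.
have [t tx] := triv_cover A x.
have [phi [K [V [[Kc KU phi0] [Vo Vx phi1]]]]] := bump_exists (triv_dom_open t) tx.
have [s sE] := frame_section (triv t x e) Kc KU phi0.
by exists s; rewrite sE phi1 // scale1r trivK.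
Qed.

(** In a local trivialization s is the combination of the frame with its
    coordinates, which vanish at x; one factor phi extends the coordinates to M
    and the other one extends the frame. *)
Lemma vanishing_section (s : sections A) x : s x = 0 ->
  exists phi : smooth_fun M, exists n, exists g : 'I_n -> smooth_fun M,
  exists e : 'I_n -> sections A,
    [/\ phi x = 1, forall i, g i x = 0 &
        section_scale phi (section_scale phi s) = \sum_i section_scale (g i) (e i)].
Proof.
move=> sx; have [t tx] := triv_cover A x.
have [phi [K [V [[Kc KU phi0] [Vo Vx phi1]]]]] := bump_exists (triv_dom_open t) tx.
exists phi, (rank t).
have sg i : smooth_fun_on setT ((phi : M -> R) * (fun y => triv t y (s y) ord0 i)).
  apply: (smooth_cut openT (triv_dom_open t) Kc KU phi0); rewrite setIT.
    exact: smooth_fun_onS (proj2_sig phi).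
  by have /asboolP := section_smooth s; exact.
exists (fun i => exist _ _ (sg i)).
have [e eE] := choice (fun i : 'I_(rank t) =>
  frame_section (delta_mx ord0 i : 'rV[R]_(rank t)) Kc KU phi0).
exists e; split; first exact: phi1.
  by move=> i; rewrite -[LHS]/(phi x * triv t x (s x) ord0 i) sx linear0 mxE mulr0.
apply: sectionP => y; rewrite section_eval_sum !section_scaleE scalerA.
have [Ky|/phi0 phiy] := pselect (K y); last first.
  rewrite phiy mul0r scale0r big1 // => i _.
  by rewrite section_scaleE eE phiy scale0r scaler0.
apply: (can_inj (trivK (KU y Ky))); rewrite linearZ linear_sum.
rewrite -[LHS]/(_ *: triv t y (s y)) [triv t y (s y)]row_sum_delta scaler_sumr.
apply: eq_bigr => i _.
rewrite section_scaleE eE !linearZ /= triv_invK; last exact: KU.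
rewrite !scalerA; congr (_ *: _).
rewrite -[RHS]/(phi y * triv t y (s y) ord0 i * phi y).
by rewrite mulrAC mulrC.
Qed.

End LocalFrames.

(** * Alternating maps and their first argument *)

Section Tuples.
Variables (R : realType) (E W : lmodType R).

Definition tcons n T (x : T) (u : 'I_n -> T) : 'I_n.+1 -> T :=
  fun i => oapp u x (unlift ord0 i).

Lemma tcons0 n T (x : T) (u : 'I_n -> T) : tcons x u ord0 = x.
Proof. by rewrite /tcons unlift_none. Qed.

Lemma tconsS n T (x : T) (u : 'I_n -> T) i : tcons x u (lift ord0 i) = u i.
Proof. by rewrite /tcons liftK. Qed.

Lemma tcons_lift0 n T (x : T) (u : 'I_n -> T) : tcons x u \o lift ord0 = u.
Proof. by apply/funext => i; rewrite /= tconsS. Qed.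

Lemma tcons_eta n T (u : 'I_n.+1 -> T) : tcons (u ord0) (u \o lift ord0) = u.
Proof.
by apply/funext => i; case: (unliftP ord0 i) => [j|] ->; rewrite ?tconsS ?tcons0.
Qed.

Lemma tcons_upd0 n T (x y : T) (u : 'I_n -> T) :
  ([eta tcons x u with ord0 |-> y] : _ -> _) = tcons y u.
Proof.
by apply/funext => i; case: (unliftP ord0 i) => [j|] ->; rewrite /= ?tconsS ?tcons0.
Qed.

Lemma tcons_updS n T (x y : T) (u : 'I_n -> T) j :
  ([eta tcons x u with lift ord0 j |-> y] : _ -> _) = tcons x [eta u with j |-> y].
Proof.
apply/funext => i; case: (unliftP ord0 i) => [k|] ->; rewrite /= ?tconsS ?tcons0 //.
Qed.

Lemma tcons_comp_lift n T (x : T) (u : 'I_n.+1 -> T) j :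
  tcons x u \o lift (lift ord0 j) = tcons x (u \o lift j).
Proof.
apply/funext => i; case: (unliftP ord0 i) => [k|] ->; last first.
  rewrite tcons0 /=.
  have -> : lift (lift ord0 j) ord0 = ord0 by apply/val_inj.
  exact: tcons0.
rewrite /= tconsS.
have -> : lift (lift ord0 j) (lift ord0 k) = lift ord0 (lift j k).
  by apply/val_inj; rewrite /= /bump /= !add1n ltnS addnS.
exact: tconsS.
Qed.

Lemma skew_tperm n (D : ('I_n -> E) -> W) u (i j : 'I_n) :
  skew D -> i != j -> D (u \o tperm i j) = - D u.
Proof. by move=> sD ij; rewrite sD odd_tperm ij expr1 scaleN1r. Qed.

(** Moving the entry x from position j to the front is a cycle of length
    j + 1. *)
Lemma skew_insert n (D : ('I_n.+1 -> E) -> W) (u : 'I_n.+1 -> E) j x :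
  skew D -> D [eta u with j |-> x] = (-1) ^+ j *: D (tcons x (u \o lift j)).
Proof.
move=> sD.
have -> : ([eta u with j |-> x] : _ -> _) = tcons x (u \o lift j) \o lift_perm j ord0 1.
  apply/funext => i; case: (unliftP j i) => [k|] -> /=.
    by rewrite eq_sym (negbTE (neq_lift _ _)) lift_perm_lift tconsS perm1.
  by rewrite eqxx lift_perm_id tcons0.
by rewrite sD odd_lift_perm odd_perm1 addbF /= addbF signr_odd.
Qed.

Lemma skew_inner n (D : ('I_n.+1 -> E) -> W) x :
  skew D -> skew (fun u => D (tcons x u)).
Proof.
move=> sD s u.
have -> : tcons x (u \o s) = tcons x u \o lift_perm ord0 ord0 s.
  apply/funext => i; case: (unliftP ord0 i) => [k|] -> /=.
    by rewrite lift_perm_lift !tconsS.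
  by rewrite lift_perm_id !tcons0.
by rewrite sD odd_lift_perm.
Qed.

(** A skew map can be evaluated with any given entry in front. *)
Lemma alternating_head n (D : ('I_n.+1 -> E) -> W) :
  skew D ->
  (forall u a e e', D (tcons (a *: e + e') u) = a *: D (tcons e u) + D (tcons e' u)) ->
  alternating D.
Proof.
move=> sD lD; split=> // i u a e e'; rewrite !skew_insert // lD scalerDr !scalerA.
by rewrite mulrC.
Qed.

(** The permutations s for which D (u o s) = sgn(s) D u are closed under product.
    They contain the transpositions that fix the first entry and the exchange of
    the first two, and conjugating yields all transpositions. *)
Lemma skew_head n (D : ('I_n.+2 -> E) -> W) :
  (forall x, skew (fun u => D (tcons x u))) ->
  (forall x y u, D (tcons x (tcons y u)) = - D (tcons y (tcons x u))) ->
  skew D.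
Proof.
move=> sD xD; pose ok (s : 'S_n.+2) := forall u, D (u \o s) = (-1) ^+ s *: D u.
have okM s t : ok s -> ok t -> ok (s * t)%g.
  move=> os ot u; have -> : u \o (s * t)%g = (u \o t) \o s.
    by apply/funext => i /=; rewrite permM.
  by rewrite os ot scalerA odd_permM signr_addb.
have okS i j : i != j -> ok (tperm (lift ord0 i) (lift ord0 j)).
  move=> ij u; rewrite odd_tperm (inj_eq (@lift_inj _ _)) ij expr1 scaleN1r.
  rewrite -[u in RHS]tcons_eta -(skew_tperm _ (sD (u ord0)) ij).
  congr D; apply/funext => k; case: (unliftP ord0 k) => [k'|] -> /=.
    by rewrite tconsS -inj_tperm //=; exact: lift_inj.
  by rewrite tcons0 tpermD.
have ok1 : ok (tperm ord0 (lift ord0 ord0)).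
  move=> u; rewrite odd_tperm expr1 scaleN1r.
  rewrite -[u in RHS]tcons_eta -[u \o lift _ in RHS]tcons_eta xD opprK.
  congr D; apply/funext => k; case: (unliftP ord0 k) => [k'|] -> /=; last first.
    by rewrite tcons0 tpermL.
  rewrite tconsS; case: (unliftP ord0 k') => [l|] -> /=.
    by rewrite tconsS tpermD // eq_sym; apply/eqP => /(congr1 val).
  by rewrite tcons0 tpermR.
have ok0 j : j != ord0 -> ok (tperm ord0 j).
  case: (unliftP ord0 j) => [{}j|] -> // _.
  have [->//|j0] := eqVneq j ord0.
  have -> : tperm ord0 (lift ord0 j) =
      (tperm ord0 (lift ord0 ord0) ^ tperm (lift ord0 ord0) (lift ord0 j))%g.
    by rewrite tpermJ tpermL tpermD.
  have := okS _ _ j0; rewrite tpermC => okj.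
  by rewrite /conjg tpermV; apply: okM okj (okM _ _ ok1 okj).
have okT i j : i != j -> ok (tperm i j).
  case: (unliftP ord0 i) => [{}i|] -> => [|ij]; last by apply: ok0; rewrite eq_sym.
  case: (unliftP ord0 j) => [{}j|] ->; last by rewrite tpermC; exact: ok0.
  by rewrite (inj_eq (@lift_inj _ _)); exact: okS.
move=> s; have [ts -> /allP tsd] := prod_tpermP s.
rewrite -/(ok _); elim: ts tsd => [_|t ts IH tsd].
  rewrite big_nil => u; rewrite odd_perm1 scale1r; congr D.
  by apply/funext => i /=; rewrite perm1.
rewrite big_cons; apply: okM; first exact/okT/tsd/mem_head.
by apply: IH => t' t'ts; apply: tsd; rewrite inE t'ts orbT.
Qed.

End Tuples.

(** * Cartan calculus of the coboundary *)

Lemma lie_commutator_AC (V : zmodType) (a b c d e f : V) :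
  a - b - (c - d) - (e - c - (b - f)) = a - e - (f - d).
Proof.
rewrite !opprB addrACA !subrKA addrACA [RHS]addrACA.
by rewrite (addrC (- f)).
Qed.

Section Cartan.
Variables (R : realType) (M : manifold R) (A : lie_algebroid M).
Implicit Types (x y z : sections A) (n : nat).

(** The interior product with [x]. *)
Definition inner n x (D : cochain A n.+1) : cochain A n :=
  fun u => D (tcons x u).

(** The Lie derivative along [x] of a cochain, for the adjoint action of
    sections on sections. *)
Definition lie n x (D : cochain A n) : cochain A n := fun u =>
  bracket x (D u) - \sum_j D [eta u with j |-> bracket x (u j)].

(** This is what allows the identities below to be proved by induction on the
    degree: it suffices to compare interior products. *)
Lemma cochainP n (D D' : cochain A n.+1) :
  (forall x, inner x D = inner x D') -> D = D'.
Proof.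
move=> e; apply/funext => u; rewrite -(tcons_eta u).
by rewrite -!/(inner _ _ _) e.
Qed.

Lemma cochainDE n (D D' : cochain A n) u : (D + D') u = D u + D' u.
Proof. by []. Qed.
Lemma cochainNE n (D : cochain A n) u : (- D) u = - D u.
Proof. by []. Qed.

Lemma bracket0r x : bracket x 0 = 0.
Proof.
have := bracket_linear x 1 0 0; rewrite !scale1r addr0 => /eqP.
by rewrite -subr_eq subrr => /eqP.
Qed.
Lemma bracketDr x y z : bracket x (y + z) = bracket x y + bracket x z.
Proof. by rewrite -[y in LHS]scale1r bracket_linear scale1r. Qed.
Lemma bracketZr a x y : bracket x (a *: y) = a *: bracket x y.
Proof. by rewrite -[a *: y in LHS]addr0 bracket_linear bracket0r addr0. Qed.
Lemma bracketNr x y : bracket x (- y) = - bracket x y.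
Proof. by rewrite -scaleN1r bracketZr scaleN1r. Qed.
Lemma bracketPl a x y z : bracket (a *: x + y) z = a *: bracket x z + bracket y z.
Proof. by rewrite bracket_skew bracket_linear opprD -scalerN -!(bracket_skew _ z). Qed.

Lemma jacobi x y z :
  bracket x (bracket y z) = bracket (bracket x y) z + bracket y (bracket x z).
Proof.
have := bracket_jacobi x y z.
rewrite (bracket_skew z x) bracketNr (bracket_skew z) => /eqP.
by rewrite -addrA addr_eq0 opprD !opprK addrC => /eqP.
Qed.

Lemma innerD n x (D D' : cochain A n.+1) :
  inner x (D + D') = inner x D + inner x D'.
Proof. by []. Qed.
Lemma innerN n x (D : cochain A n.+1) : inner x (- D) = - inner x D.
Proof. by []. Qed.
Lemma innerPl n a x y (D : cochain A n.+1) : alternating D ->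
  inner (a *: x + y) D = a *: inner x D + inner y D.
Proof.
move=> [lD _]; apply/funext => u; rewrite fct_linE /inner.
by rewrite -(tcons_upd0 0) lD !tcons_upd0.
Qed.

Lemma lieD n x (D D' : cochain A n) : lie x (D + D') = lie x D + lie x D'.
Proof.
apply/funext => u; rewrite cochainDE /lie cochainDE bracketDr.
under eq_bigr do rewrite cochainDE.
by rewrite big_split /= opprD addrACA.
Qed.

Lemma lieN n x (D : cochain A n) : lie x (- D) = - lie x D.
Proof.
apply/funext => u; rewrite cochainNE /lie cochainNE bracketNr.
under eq_bigr do rewrite cochainNE.
by rewrite sumrN opprD.
Qed.

Lemma lieB n x (D D' : cochain A n) : lie x (D - D') = lie x D - lie x D'.
Proof. by rewrite lieD lieN. Qed.

Lemma lieZ n x a (D : cochain A n) : lie x (a *: D) = a *: lie x D.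
Proof.
apply/funext => u; rewrite -[RHS]/(a *: lie x _ u) /lie scalerBr -bracketZr.
by rewrite scaler_sumr.
Qed.

Lemma lie0E x (D : cochain A 0) u : lie x D u = bracket x (D u).
Proof. by rewrite /lie big_ord0 subr0. Qed.

(** The Cartan relation between L_x and i_y: the action on the entry [y] is the
    summand j = 0 of the Lie derivative. *)
Lemma inner_lie n x y (D : cochain A n.+1) :
  inner y (lie x D) = lie x (inner y D) - inner (bracket x y) D.
Proof.
apply/funext => u; rewrite cochainDE cochainNE /inner /lie big_ord_recl.
rewrite tcons_upd0 tcons0 opprD addrCA addrC; congr (_ - _ - _).
by apply: eq_bigr => j _; rewrite tcons_updS tconsS.
Qed.

Lemma alternating_inner n x (D : cochain A n.+1) :
  alternating D -> alternating (inner x D).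
Proof.
move=> [lD sD]; split; last exact: skew_inner.
by move=> i u a e e'; rewrite /inner -!tcons_updS lD.
Qed.

Lemma skew_lie n x (D : cochain A n) : skew D -> skew (lie x D).
Proof.
move=> sD s u; rewrite /lie sD bracketZr scalerBr; congr (_ - _).
rewrite scaler_sumr (reindex_perm s^-1%g) /=; apply: eq_bigr => j _.
rewrite -sD; congr D; apply/funext => i /=.
by rewrite permKV -(inj_eq (@perm_inj _ s)) permKV.
Qed.

Lemma alternating_lie n x (D : cochain A n) : alternating D -> alternating (lie x D).
Proof.
case: n D => [|n] D aD; first by split=> [[]//|]; exact: skew_lie aD.2.
apply: alternating_head => [|u a e e']; first exact: skew_lie aD.2.
rewrite -/(inner _ _ _) inner_lie bracket_linear !innerPl //.
rewrite lieD -[lie x D (tcons e u)]/(inner e _ u).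
rewrite -[lie x D (tcons e' u)]/(inner e' _ u) !inner_lie.
rewrite lieZ !cochainDE !cochainNE fct_linE -[(a *: _) u]/(a *: lie x _ u) [RHS]addrC.
rewrite [in RHS]scalerBr [RHS]addrC.
by rewrite opprD addrACA.
Qed.

(** The case of degree 0 is the Jacobi identity, and interior products lower the
    degree. *)
Lemma lie_commutator n x y (D : cochain A n) : alternating D ->
  lie x (lie y D) - lie y (lie x D) = lie (bracket x y) D.
Proof.
elim: n D => [|n IH] D aD.
  by apply/funext => u; rewrite cochainDE cochainNE !lie0E jacobi addrK.
apply: cochainP => z.
rewrite innerD innerN !inner_lie (lieB x (lie y _)) (lieB y (lie x _)) -IH; last first.
  exact: alternating_inner.
have -> : inner (bracket (bracket x y) z) D =
    inner (bracket x (bracket y z)) D - inner (bracket y (bracket x z)) D.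
  by rewrite -(addrK (bracket y (bracket x z)) (bracket (bracket x y) z)) -jacobi
    addrC -scaleN1r innerPl // scaleN1r addrC.
exact: lie_commutator_AC.
Qed.

Lemma lie_commute n x y (D : cochain A n) : alternating D ->
  lie x (lie y D) = lie (bracket x y) D + lie y (lie x D).
Proof. by move=> aD; rewrite -lie_commutator // subrK. Qed.

Lemma bumpSS h k : bump h.+1 k.+1 = (bump h k).+1.
Proof. by rewrite /bump ltnS addnS. Qed.

Lemma contract_tcons0 n x (u : 'I_n.+1 -> sections A) j :
  contract (tcons x u) ord0 (lift ord0 j) = tcons (bracket x (u j)) (u \o lift j).
Proof.
apply/funext => k; case: (unliftP ord0 k) => [k'|] ->; last first.
  by rewrite /contract !tcons0 tconsS.
rewrite [RHS]tconsS /contract /= -[RHS](tconsS x u); congr tcons.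
by apply/ord_inj; rewrite lift0 bumpSS inordK // ltnS; exact: (ltn_ord (lift j k')).
Qed.

(** [contract] puts the bracket [u_i, u_j] in front of [x]; the transposition of
    the first two entries accounts for this. *)
Lemma contract_tconsS n x (u : 'I_n.+2 -> sections A) (i j : 'I_n.+2) : (i < j)%N ->
  contract (tcons x u) (lift ord0 i) (lift ord0 j) =
  tcons x (contract u i j) \o tperm ord0 (lift ord0 ord0).
Proof.
move=> ij; apply/funext => k; case: (unliftP ord0 k) => [k'|] ->; last first.
  by rewrite /= tpermL tconsS /contract /= !tconsS.
case: (unliftP ord0 k') => [l|] ->; last first.
  rewrite /= tpermR tcons0 /contract /=.
  by rewrite (_ : inord _ = ord0) ?tcons0 //; apply/ord_inj; rewrite inordK.
rewrite [RHS]/= tpermD; last 2 first.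
  by [].
  by apply/eqP => /(congr1 val).
rewrite tconsS /contract /=.
have bnd : (bump j (bump i l) < n.+2)%N.
  have bumpS h m : (bump h m <= m.+1)%N by rewrite /bump; case: (h <= m)%N.
  by rewrite (leq_ltn_trans (bumpS _ _)) // !ltnS (leq_trans (bumpS _ _)).
rewrite -[RHS](tconsS x); congr tcons; apply/ord_inj.
by rewrite !lift0 !bumpSS !inordK.
Qed.

Lemma sum_lt_recl (V : nmodType) n (F : 'I_n.+1 -> 'I_n.+1 -> V) :
  \sum_(i < n.+1) \sum_(j < n.+1 | (i < j)%N) F i j =
  \sum_(j < n) F ord0 (lift ord0 j) +
  \sum_(i < n) \sum_(j < n | (i < j)%N) F (lift ord0 i) (lift ord0 j).
Proof.
have recl (i : 'I_n.+1) : \sum_(j < n.+1 | (i < j)%N) F i j =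
    \sum_(j < n | (i < lift ord0 j)%N) F i (lift ord0 j).
  by rewrite big_mkcond [RHS]big_mkcond big_ord_recl ltn0; exact: add0r.
rewrite big_ord_recl recl; congr (_ + _).
by apply: eq_bigr => i _; rewrite recl; apply: eq_bigl => j; rewrite !lift0.
Qed.

Lemma inner_delta0 x (D : cochain A 0) : inner x (delta D) = lie x D.
Proof.
apply/funext => u; rewrite lie0E /inner /delta.
rewrite !big_ord_recl !big_ord0 !addr0 big1 => [|[[|//] //] //].
by rewrite addr0 scale1r tcons0 tcons_lift0.
Qed.

(** Cartan's formula i_x d + d i_x = L_x. The summand i = 0 of the first sum and
    the summands i = 0 of the double sum form L_x; the remaining ones form
    - d i_x, where the signs of the double sum come from exchanging [x] with the
    bracket. It serves as a recursive definition of [delta], from which the next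
    lemmas follow by induction without using the explicit sums. *)
Lemma inner_delta n x (D : cochain A n.+1) : skew D ->
  inner x (delta D) = lie x D - delta (inner x D).
Proof.
move=> sD; apply/funext => u; rewrite cochainDE cochainNE /inner /delta /lie.
rewrite big_ord_recl tcons0 scale1r tcons_lift0 -!addrA; congr (_ + _).
rewrite sum_lt_recl addrCA opprD; congr (_ + (_ + _)).
- rewrite -sumrN; apply: eq_bigr => j _; rewrite contract_tcons0.
  by rewrite lift0 add0n exprS mulN1r scaleNr skew_insert.
- rewrite -sumrN; apply: eq_bigr => i _.
  by rewrite tconsS tcons_comp_lift lift0 exprS mulN1r scaleNr.
rewrite -sumrN; apply: eq_bigr => i _; rewrite -sumrN.
case: n => [|n] in D sD u i *.
  by rewrite !big1 // => j; rewrite !ord1.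
apply: eq_bigr => j ij; rewrite contract_tconsS // skew_tperm //.
by rewrite !lift0 addnS addSn !exprS !mulN1r opprK scalerN.
Qed.

Lemma lie_delta_AC (V : zmodType) (b c p q : V) :
  c + b - p - (c - q) = b - (p - q).
Proof. by rewrite !opprB -(addrA c) [LHS]addrC addrA subrK addrCA. Qed.

Lemma delta_skew0_AC (V : zmodType) (a b c : V) : a - c - b = - (b - - c - a).
Proof. by rewrite opprK opprB opprD addrA addrAC. Qed.

Lemma delta_skew_AC (V : zmodType) (a b c d : V) :
  a - c - (b - d) = - (b - - c - (a - - d)).
Proof. by rewrite !opprK opprB opprB opprD addrACA (addrC (- c)) addrA. Qed.

Lemma deltaB n (D D' : cochain A n) : delta (D - D') = delta D - delta D'.
Proof. exact: (linearB (@delta R M A n)). Qed.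

Lemma deltaN n (D : cochain A n) : delta (- D) = - delta D.
Proof. exact: (linearN (@delta R M A n)). Qed.

Lemma innerB n x (D D' : cochain A n.+1) :
  inner x (D - D') = inner x D - inner x D'.
Proof. by []. Qed.

Lemma innerNl n x (D : cochain A n.+1) : alternating D ->
  inner (- x) D = - inner x D.
Proof.
move=> aD; have i0 : inner 0 D = 0.
  by have := innerPl (-1) 0 0 aD; rewrite scaler0 addr0 scaleN1r addNr.
by rewrite -scaleN1r -[_ *: x]addr0 innerPl // scaleN1r i0 addr0.
Qed.

Lemma deltaP n a (D D' : cochain A n) :
  delta (a *: D + D') = a *: delta D + delta D'.
Proof. exact: delta_linear. Qed.

Lemma liePl n a x y (D : cochain A n) : alternating D ->
  lie (a *: x + y) D = a *: lie x D + lie y D.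
Proof.
move=> [lD _]; apply/funext => u; rewrite fct_linE /lie bracketPl.
under eq_bigr do rewrite bracketPl lD.
by rewrite big_split -scaler_sumr /= opprD addrACA -scalerBr.
Qed.

(** Both i_y L_x d and i_y d L_x are reduced by the Cartan relations to terms of
    lower degree; they agree by the induction hypothesis for i_y D and by
    L_x L_y = L_[x, y] + L_y L_x. *)
Lemma lie_delta n x (D : cochain A n) : alternating D ->
  lie x (delta D) = delta (lie x D).
Proof.
elim: n D => [|n IH] D aD.
  apply: cochainP => y; rewrite inner_lie !inner_delta0.
  by rewrite lie_commute // [in LHS]addrC addKr.
apply: cochainP => y; have aiD := alternating_inner y aD.
have sD := aD.2; have slD := skew_lie x sD.
rewrite inner_lie !inner_delta //.
rewrite (lieB x (lie y D)) inner_lie deltaB IH // lie_commute //.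
exact: lie_delta_AC.
Qed.

(** By Cartan's formula i_x (delta D) is alternating by induction. There remains
    the exchange of the first two entries:
    i_y i_x d D = L_x i_y D - i_[x, y] D - L_y i_x D + d (i_y i_x D), which is
    visibly skew in x and y. *)
Lemma delta_alternating n (D : cochain A n) : alternating D -> alternating (delta D).
Proof.
elim: n D => [|n IH] D aD; have sD := aD.2.
  apply: alternating_head => [s u|u a e e'].
    rewrite [s](_ : _ = 1%g); last by apply/permP => i; rewrite !ord1.
    rewrite odd_perm1 scale1r; congr delta.
    by apply/funext => i; rewrite /= perm1.
  rewrite -!/(inner _ _ _) !inner_delta0 !lie0E.
  exact: bracketPl.
have lin u a e e' : delta D (tcons (a *: e + e') u) =
    a *: delta D (tcons e u) + delta D (tcons e' u).
  rewrite -!/(inner _ _ _) !inner_delta //.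
  rewrite innerPl // deltaP liePl // opprD addrACA -scalerBr.
  by rewrite fct_linE.
refine (alternating_head _ lin); apply: skew_head => [x|x y u].
  rewrite -[X in skew X]/(inner x (delta D)) inner_delta //.
  have [_ s1] := alternating_lie x aD.
  have [_ s2] := IH _ (alternating_inner x aD).
  by move=> s u; rewrite cochainDE cochainNE s1 s2 -scalerBr.
suff anti : inner y (inner x (delta D)) =
    - inner x (inner y (delta D)).
  by rewrite -!/(inner _ _ _) anti.
rewrite !inner_delta // (innerB y (lie x D)) (innerB x (lie y D)).
rewrite !inner_lie (bracket_skew y) innerNl //.
case: n => [|n] in IH D aD sD lin u *.
  by rewrite !inner_delta0; exact: delta_skew0_AC.
have six := skew_inner x sD; have siy := skew_inner y sD.
rewrite !inner_delta //.
have -> : inner x (inner y D) = - inner y (inner x D).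
  apply/funext => v; rewrite cochainNE /inner.
  have -> : tcons y (tcons x v) = tcons x (tcons y v) \o tperm ord0 (lift ord0 ord0).
    apply/funext => i; case: (unliftP ord0 i) => [j|] ->; last first.
      by rewrite /= tpermL tconsS !tcons0.
    case: (unliftP ord0 j) => [k|] ->; last first.
      by rewrite /= tpermR tconsS !tcons0.
    by rewrite /= tpermD ?tconsS //; apply/eqP => /(congr1 val).
  by rewrite skew_tperm.
rewrite deltaN; exact: delta_skew_AC.
Qed.

(** i_x d d D = L_x d D - d (L_x D - d i_x D) = d d (i_x D). *)
Lemma delta_delta n (D : cochain A n) : alternating D -> delta (delta D) = 0.
Proof.
elim: n D => [|n IH] D aD; apply: cochainP => x;
  have sD := aD.2; have sD' := (delta_alternating aD).2.
  by rewrite inner_delta // inner_delta0 lie_delta // subrr.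
rewrite !inner_delta // deltaB IH ?subr0; last exact: alternating_inner.
by rewrite lie_delta // subrr.
Qed.

End Cartan.

(** * Symbol of a coboundary *)

Section Symbols.
Variables (R : realType) (M : manifold R) (A : lie_algebroid M).
Implicit Types (x y : sections A) (f : smooth_fun M) (n : nat).

Definition anchor_fun x f : smooth_fun M :=
  exist _ (fun p => anchor A p (x p) f) (tangent_map_smooth (anchor A) x f).

Lemma bracket_scaler f x y :
  bracket x (section_scale f y) =
  section_scale f (bracket x y) + section_scale (anchor_fun x f) y.
Proof. by apply: sectionP => p; rewrite bracket_leibniz. Qed.

Lemma bracket_scalel f x y :
  bracket (section_scale f x) y =
  section_scale f (bracket x y) - section_scale (anchor_fun y f) x.
Proof.
apply: sectionP => p; rewrite bracket_skew bracket_scaler (bracket_skew x).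
by rewrite !(section_evalD, section_evalN, section_scaleE) scalerN opprD.
Qed.

Definition scale_cochain n f (D : cochain A n) : cochain A n :=
  fun u => section_scale f (D u).

(** Only the bracket in the first sum differentiates f: the double sum defining
    the coboundary is linear over functions. *)
Lemma delta_scale n f (D : cochain A n) u p :
  delta (scale_cochain f D) u p = f p *: delta D u p +
  \sum_(i < n.+1) (-1) ^+ i *: (anchor_fun (u i) f p *: D (u \o lift i) p).
Proof.
rewrite /delta !section_evalD !section_eval_sum scalerDr [RHS]addrAC !scaler_sumr.
congr (_ + _); first rewrite -big_split; apply: eq_bigr => i _.
  rewrite bracket_scaler !section_evalZ !section_evalD !section_scaleE.
  by rewrite scalerDr !scalerA mulrC.
rewrite !section_eval_sum scaler_sumr; apply: eq_bigr => j _.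
by rewrite !section_evalZ section_scaleE !scalerA mulrC.
Qed.

Lemma cochainBE n (D D' : cochain A n) u p : (D - D') u p = D u p - D' u p.
Proof. by []. Qed.

Definition tensorial n (D : cochain A n) : Prop :=
  forall (j : 'I_n) u f x p,
  D [eta u with j |-> section_scale f x] p = f p *: D [eta u with j |-> x] p.

Lemma tensorial_tcons n (D : cochain A n.+1) u f x p : tensorial D ->
  D (tcons (section_scale f x) u) p = f p *: D (tcons x u) p.
Proof. by move=> tD; rewrite -(tcons_upd0 0) tD tcons_upd0. Qed.

Lemma tensorialP n (D : cochain A n.+1) : skew D ->
  (forall u f x p, D (tcons (section_scale f x) u) p = f p *: D (tcons x u) p) ->
  tensorial D.
Proof.
move=> sD tD j u f x p; rewrite !skew_insert // !section_evalZ tD.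
by rewrite !scalerA mulrC.
Qed.

Lemma alternatingB n (D : cochain A n) i u x y : alternating D ->
  D [eta u with i |-> x - y] = D [eta u with i |-> x] - D [eta u with i |-> y].
Proof. by move=> [lD _]; rewrite addrC -scaleN1r lD scaleN1r addrC. Qed.

Lemma lie_scale n (D : cochain A n) u f x p : alternating D -> tensorial D ->
  lie (section_scale f x) D u p =
    f p *: lie x D u p - anchor A p (D u p) f *: x p +
    \sum_j anchor_fun (u j) f p *: D [eta u with j |-> x] p.
Proof.
move=> aD tD; rewrite /lie !section_evalD !section_evalN !section_eval_sum.
rewrite bracket_scalel section_evalD section_evalN !section_scaleE scalerBr.
rewrite [LHS]addrAC [RHS]addrAC; congr (_ - _).
rewrite -[RHS]addrA; congr (_ + _).
rewrite scaler_sumr -sumrN -sumrN -big_split; apply: eq_bigr => j _.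
by rewrite bracket_scalel alternatingB // section_evalD section_evalN !tD opprB addrC.
Qed.

(** In Cartan's formula f x enters through L_(f x) and through i_(f x) = f i_x;
    the terms containing the derivative of f along an entry u_j cancel, and only
    the derivative along D u survives. So the symbol of delta D is a D up to
    sign. *)
Lemma delta_symbol n (D : cochain A n) u f x p : alternating D -> tensorial D ->
  delta D (tcons (section_scale f x) u) p =
    f p *: delta D (tcons x u) p - anchor A p (D u p) f *: x p.
Proof.
case: n D u => [|n] D u aD tD; rewrite -!/(inner _ _ _).
  by rewrite !inner_delta0 !lie0E bracket_scalel.
have sD := aD.2; rewrite !inner_delta //.
have -> : inner (section_scale f x) D = scale_cochain f (inner x D).
  by apply/funext => v; apply: sectionP => q; rewrite /inner tensorial_tcons.
rewrite (cochainBE (lie _ D)) (cochainBE (lie x D)) delta_scale lie_scale //.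
rewrite (scalerBr (f p) (lie x D u p)).
have -> : \sum_(i < n.+1) (-1) ^+ i *:
      (anchor_fun (u i) f p *: inner x D (u \o lift i) p) =
    \sum_j anchor_fun (u j) f p *: D [eta u with j |-> x] p.
  apply: eq_bigr => j _; rewrite skew_insert // section_evalZ !scalerA.
  by rewrite mulrC.
by rewrite [X in _ - X]addrC addrKA addrAC.
Qed.

End Symbols.

(** * Tensorial cochains and bundle maps *)

Section Tensorial.
Variables (R : realType) (M : manifold R) (A : lie_algebroid M).
Implicit Types (x : M) (n : nat).

Definition tensor_cochain n (D : cochain A n)
    (om : forall x, ('I_n -> A x) -> A x) : Prop :=
  (forall x, alternating (om x)) /\ forall u x, D u x = om x (fun i => u i x).

Lemma upd_eval n (u : 'I_n -> sections A) j s x :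
  (fun i => [eta u with j |-> s] i x) = [eta (fun i => u i x) with j |-> s x].
Proof. by apply/funext => i /=; case: eqP. Qed.

Lemma tensor_cochain_alternating n (D : cochain A n) om :
  tensor_cochain D om -> alternating D.
Proof.
move=> [al omE]; split=> [i u a e e'|s u]; apply: sectionP => x.
  rewrite section_evalP !omE !upd_eval section_evalP.
  exact: (al x).1.
rewrite section_evalZ !omE -(al x).2.
by congr (om x).
Qed.

Lemma tensor_cochain_tensorial n (D : cochain A n) om :
  tensor_cochain D om -> tensorial D.
Proof.
move=> [al omE] j u f s x; rewrite !omE !upd_eval section_scaleE.
rewrite -[f x *: s x]addr0 (al x).1 -[X in _ + X = _](_ : 0 = _) ?addr0 //.
have := (al x).1 j (fun i => u i x) (-1) 0 0.
by rewrite scaler0 addr0 scaleN1r addNr.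
Qed.

Lemma multilinear_sum n (E W : lmodType R) (D : ('I_n -> E) -> W) j u m (F : 'I_m -> E) :
  multilinear D ->
  D [eta u with j |-> \sum_i F i] = \sum_i D [eta u with j |-> F i].
Proof.
move=> lD; have D0 : D [eta u with j |-> 0] = 0.
  by have := lD j u (-1) 0 0; rewrite scaler0 addr0 scaleN1r addNr.
elim/big_rec2: _ => // i a b _ <-.
by rewrite -[F i]scale1r lD !scale1r.
Qed.

(** Choose phi with phi(x) = 1 as in [vanishing_section]: the value at x does not
    change when s is multiplied by phi^2, which turns s into a combination of
    sections with coefficients vanishing at x. *)
Lemma tensorial_vanish n (D : cochain A n) (u : 'I_n -> sections A) j
    (s : sections A) x :
  alternating D -> tensorial D -> s x = 0 -> D [eta u with j |-> s] x = 0.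
Proof.
move=> [lD _] tD /vanishing_section[phi [m [g [e [phix gx sE]]]]].
rewrite -[LHS]scale1r -phix -tD -[LHS]scale1r -phix -tD sE.
rewrite multilinear_sum // section_eval_sum big1 // => i _.
by rewrite tD gx scale0r.
Qed.

(** The entries of u are replaced by those of v one at a time. *)
Lemma tensorial_local n (D : cochain A n) (u v : 'I_n -> sections A) x :
  alternating D -> tensorial D -> (forall i, u i x = v i x) -> D u x = D v x.
Proof.
move=> aD tD uv; pose w k : 'I_n -> sections A := fun i => if (i < k)%N then v i else u i.
have step k : (k < n)%N -> D (w k) x = D (w k.+1) x.
  move=> kn; pose j := Ordinal kn.
  have wk s : s = w k j -> w k = [eta w k with j |-> s] :> (_ -> _).
    by move=> ->; apply/funext => i /=; case: eqP => // ->.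
  have -> : w k.+1 = [eta w k with j |-> v j] :> (_ -> _).
    apply/funext => i /=; rewrite /w ltnS leq_eqVlt -val_eqE /=.
    by case: eqP => //= ik; congr v; apply/ord_inj.
  rewrite {1}(wk (u j)); last by rewrite /w ltnn.
  apply/eqP; rewrite -subr_eq0 -section_evalN -section_evalD -alternatingB //.
  by rewrite tensorial_vanish // section_evalD section_evalN uv subrr.
have all_k k : (k <= n)%N -> D u x = D (w k) x.
  elim: k => [_|k IH kn]; last by rewrite (IH (ltnW kn)) step.
  by congr (D _ x); apply/funext => i; rewrite /w ltn0.
rewrite (all_k n) //; congr (D _ x); apply/funext => i.
by rewrite /w ltn_ord.
Qed.

(** The fibre map at x evaluates D on sections through the given vectors; by
    [tensorial_local] their choice does not matter. *)
Lemma tensorial_tensor_cochain n (D : cochain A n) :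
  alternating D -> tensorial D -> exists om, tensor_cochain D om.
Proof.
move=> aD tD.
have [sec secE] : exists sec : forall x, A x -> sections A, forall x e, sec x e x = e.
  have h x : exists s : A x -> sections A, forall e, s e x = e.
    by have [g gE] := choice (@section_through _ _ A x); exists g.
  exists (fun x => projT1 (cid (h x))) => x e.
  exact: (projT2 (cid (h x))).
exists (fun x e => D (fun i => sec x (e i)) x); split=> [x|u x]; last first.
  by apply: tensorial_local => // i; rewrite secE.
split=> [i u a e e'|s u]; last first.
  by rewrite -section_evalZ -aD.2.
rewrite -section_evalZ -section_evalD.
pose v : 'I_n -> sections A := fun k => sec x (u k).
have loc e1 (s : sections A) : s x = e1 ->
    D (fun k => sec x ([eta u with i |-> e1] k)) x = D [eta v with i |-> s] x.
  move=> <-; apply: tensorial_local => // k /=; case: eqP => _; by rewrite ?secE.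
rewrite (loc _ (a *: sec x e + sec x e')); last by rewrite section_evalP !secE.
rewrite section_evalD section_evalZ.
by rewrite (loc e (sec x e)) // (loc e' (sec x e')) // aD.1.
Qed.

End Tensorial.

(** * Coordinates near a point *)

Section Coordinates.
Variables (R : realType) (M : manifold R).
Implicit Types (x : M) (f : smooth_fun M).

Lemma smooth_fun_continuous f : continuous (f : M -> R).
Proof.
move=> x; have [c cx] := chart_cover x.
have fc := differentiable_continuous (smooth_fun_differentiable f cx).
have : (f \o chart_inv c) \o chart c @ x --> f x.
  have -> : f x = (f \o chart_inv c) (chart c x) by rewrite /= chartK.
  by apply: continuous_cvg => //; exact: chart_continuous.
apply: cvg_trans; apply: near_eq_cvg; near=> y.
have cy : chart_dom c y by near: y; exact: open_nbhs_nbhs (conj (chart_dom_open c) cx).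
by rewrite /= chartK.
Unshelve. all: by end_near. Qed.

Lemma smooth_fun_on_det n (B : M -> 'M[R]_n) :
  (forall i j, smooth_fun_on setT (fun x => B x i j)) ->
  smooth_fun_on setT (fun x => \det (B x)).
Proof.
move=> sB; apply: (smooth_fun_on_sum openT) => s _.
apply: (@smooth_fun_onM _ _ setT (cst ((-1) ^+ s)) (fun x => \prod_i B x i (s i)) openT).
  exact: smooth_fun_on_cst.
by apply: (smooth_fun_on_prod openT).
Qed.

Lemma smooth_fun_on_adj n (B : M -> 'M[R]_n) i j :
  (forall i j, smooth_fun_on setT (fun x => B x i j)) ->
  smooth_fun_on setT (fun x => (\adj (B x)) i j).
Proof.
move=> sB; under eq_fun do rewrite mxE.
apply: (@smooth_fun_onM _ _ setT (cst ((-1) ^+ (j + i)))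
  (fun x => \det (row' j (col' i (B x)))) openT); first exact: smooth_fun_on_cst.
apply: (@smooth_fun_on_det _ (fun x => row' j (col' i (B x)))) => k l.
rewrite (_ : (fun x => _) = (fun x => B x (lift j k) (lift i l))) //.
by apply/funext => x; rewrite !mxE.
Qed.

(** Tangent vectors act on globally defined functions only, so the coordinates of
    a chart are cut off by a bump function. *)
Lemma coordinates_exist x : exists c, exists X : 'I_(dim M) -> smooth_fun M, exists V,
  [/\ open V, V x & V `<=` chart_dom c] /\
  forall y, V y -> forall w i, chart_vector c y w (X i) = w ord0 i.
Proof.
have [c cx] := chart_cover x; have co := chart_dom_open c.
have [phi [K [V [[Kc KU phi0] [Vo Vx phi1]]]]] := bump_exists co cx.
have sX i : smooth_fun_on setT ((phi : M -> R) * (fun y => chart c y ord0 i)).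
  apply: (smooth_cut openT co Kc KU phi0); rewrite setIT.
    exact: smooth_fun_onS (proj2_sig phi).
  exact: smooth_chart_coord.
exists c, (fun i => exist _ _ (sX i)), (V `&` chart_dom c).
split; first by split=> [||y []] //; exact: openI.
move=> y [Vy cy] w i; rewrite /chart_vector.
have -> : w ord0 i = 'D_w (fun z : 'rV[R]_(dim M) => z ord0 i : R^o) (chart c y).
  have := @derive_mx _ _ _ _ (id : 'rV[R]_(dim M) -> 'rV[R]_(dim M)) (chart c y) w
    (@derivable_id _ _ _ _).
  by rewrite derive_id => /matrixP /(_ ord0 i); rewrite mxE.
apply: near_eq_derive.
apply: filterS (open_nbhs_nbhs (conj (chart_img_openI (c := c) Vo) _)); last by exists y.
move=> _ [z [Vz cz] <-] /=; rewrite chartK //.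
by rewrite -[LHS]/(phi z * chart c z ord0 i) phi1 // mul1r.
Qed.

Lemma tangent_coordinates x c (X : 'I_(dim M) -> smooth_fun M) v v' :
  chart_dom c x -> (forall w i, chart_vector c x w (X i) = w ord0 i) ->
  tangent x v -> tangent x v' -> (forall i, v (X i) = v' (X i)) -> v = v'.
Proof.
move=> cx Xc [c1 [w1 [c1x ->]]] [c2 [w2 [c2x ->]]].
rewrite (chart_vector_change w1 cx c1x) (chart_vector_change w2 cx c2x) => e.
congr chart_vector; apply/rowP => i.
by have := e i; rewrite !Xc.
Qed.

End Coordinates.

(** * Smooth splittings of the anchor *)

Section Lifts.
Variables (R : realType) (M : manifold R) (A : lie_algebroid M).
Implicit Types (x : M) (f : smooth_fun M).

(** A candidate for a right inverse of the anchor. It is defined on all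
    operators, so that it can be linear although the tangent vectors only form a
    subset of them. *)
Definition lifting := forall x, (smooth_fun M -> R^o) -> A x.

Definition smooth_lifting (Lam : lifting) : Prop :=
  (forall x, linear (Lam x)) /\
  forall tau : forall x : M, smooth_fun M -> R^o,
    (forall f, smooth_fun_on setT (fun x => tau x f)) ->
    smooth_section_pred (fun x => Lam x (tau x)).

Lemma smooth_lifting0 : smooth_lifting (fun x v => 0).
Proof.
split=> [x a u v|tau _]; first by rewrite scaler0 addr0.
exact: (section_smooth (0 : sections A)).
Qed.

Lemma smooth_liftingD (f : M -> R) (L L' : lifting) : smooth_fun_on setT f ->
  smooth_lifting L -> smooth_lifting L' ->
  smooth_lifting (fun x v => L x v + f x *: L' x v).
Proof.
move=> sf [lL sL] [lL' sL']; split=> [x a u v|tau st].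
  by rewrite lL lL' !scalerDr addrACA !scalerA (mulrC (f x)).
pose s : sections A := Section (sL _ st) +
  section_scale (exist _ f sf) (Section (sL' _ st)).
exact: (section_smooth s).
Qed.

(** Choose sections s_j whose anchors at x are the coordinate vectors and let m
    be the matrix of the coordinates of their anchors. It is the identity at x,
    hence invertible nearby, and the lift of v is the combination of the s_j with
    coefficients (v X) m^-1. The inverse is written q adj(m), where q is a smooth
    extension of 1/det(m), so that the lift is smooth on all of M. *)
Lemma local_lifting x : is_transitive A ->
  exists L : lifting, exists V, [/\ smooth_lifting L, open V, V x &
    forall y v, V y -> tangent y v -> anchor A y (L y v) = v].
Proof.
move=> tA; have [c [X [V [[Vo Vx Vc] Xc]]]] := coordinates_exist x.
have cx := Vc x Vx.
have [s sE] : exists s : 'I_(dim M) -> sections A,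
    forall j, anchor A x (s j x) = chart_vector c x (delta_mx ord0 j).
  suff h j : exists sj : sections A, anchor A x (sj x) = chart_vector c x (delta_mx ord0 j).
    by have [s sE] := choice h; exists s.
  have [|e eE] := tA x (chart_vector c x (delta_mx ord0 j)).
    by exists c, (delta_mx ord0 j).
  by have [s sx] := section_through e; exists s; rewrite sx.
pose m y : 'M[R]_(dim M) := \matrix_(j, i) anchor A y (s j y) (X i).
have sm i j : smooth_fun_on setT (fun y => m y i j).
  by under eq_fun do rewrite mxE; exact: tangent_map_smooth.
pose Dt : smooth_fun M := exist _ _ (smooth_fun_on_det sm).
have Dx : Dt x = 1.
  rewrite -[LHS]/(\det (m x)) (_ : m x = 1%:M) ?det1 //.
  by apply/matrixP => j i; rewrite !mxE sE Xc // mxE eqxx /= eq_sym.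
pose W := [set y | Dt y != 0].
have Wo : open W.
  apply: (@open_comp _ _ (Dt : M -> R) [set t : R | t != 0]).
    by move=> y _; exact: smooth_fun_continuous.
  exact: open_neq.
have Wx : W x by rewrite /W -[_ x]/(is_true (Dt x != 0)) Dx oner_neq0.
have sV : smooth_fun_on W (fun y => (Dt y)^-1).
  by apply: smooth_fun_onV => //; exact: smooth_fun_onS (proj2_sig Dt).
have [q [V' [Vo' Vx' VW' qE]]] := smooth_extension Wo Wx sV.
pose h j (y : M) (v : smooth_fun M -> R^o) : R :=
  \sum_i v (X i) * (q y * (\adj (m y)) i j).
exists (fun y v => \sum_j h j y v *: s j y), (V `&` V').
split; [|exact: openI|by split|].
- split=> [y a u v|tau st].
    rewrite scaler_sumr -big_split; apply: eq_bigr => j _ /=.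
    rewrite scalerA -scalerDl; congr (_ *: _).
    rewrite /h mulr_sumr -big_split; apply: eq_bigr => i _ /=.
    by rewrite fct_linE mulrDl; congr (_ + _); exact: esym (mulrA _ _ _).
  have sh j : smooth_fun_on setT (fun y => h j y (tau y)).
    apply: (smooth_fun_on_sum openT) => i _.
    apply: (smooth_fun_onM openT (st _)).
    apply: (smooth_fun_onM openT (proj2_sig q)).
    exact: smooth_fun_on_adj.
  have := section_smooth (\sum_j section_scale (exist _ _ (sh j)) (s j)).
  congr (is_true (smooth_section_pred _)).
  by apply/functional_extensionality_dep => y; rewrite -/(section_eval _ y) section_eval_sum.
move=> y v [Vy Vy'] tv; apply: (tangent_coordinates (Vc y Vy) (Xc y Vy)) => //.
  exact: tangent_map_tangent.
move=> k; rewrite linear_sum fct_sumE.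
pose r : 'rV[R]_(dim M) := \row_i v (X i).
have hE j : h j y v = (r *m (q y *: \adj (m y))) ord0 j.
  by rewrite mxE; apply: eq_bigr => i _; rewrite !mxE.
transitivity ((r *m (q y *: \adj (m y)) *m m y) ord0 k).
  rewrite [RHS]mxE; apply: eq_bigr => j _.
  by rewrite linearZ hE [m y j k]mxE.
have qD : q y * \det (m y) = 1.
  by rewrite qE // mulVf //; exact: VW'.
by rewrite -mulmxA -scalemxAl mul_adj_mx scale_scalar_mx qD mulmx1 mxE.
Qed.

(** A lifting that is a right inverse of the anchor wherever [phi] does not
    vanish; the last clause expresses this by multiplication with [phi], which is
    the form in which it enters the sum over the partition of unity. *)
Definition partial_lifting (L : lifting) (phi : M -> R) (V : set M) : Prop :=
  [/\ smooth_lifting L, smooth_fun_on setT phi, open V,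
      forall y, V y -> phi y = 1 &
      forall y v, tangent y v -> phi y *: anchor A y (L y v) = phi y *: v].

Lemma partial_lifting_at x : is_transitive A ->
  exists L phi V, partial_lifting L phi V /\ V x.
Proof.
move=> /(local_lifting x)[L [U [sL Uo Ux LU]]].
have [phi [K [V [[Kc KU phi0] [Vo Vx phi1]]]]] := bump_exists Uo Ux.
exists L, phi, V; split=> //; split=> //; first exact: (proj2_sig phi).
move=> y v tv; have [/KU Uy|/phi0 ->] := pselect (K y); first by rewrite LU.
by rewrite !scale0r.
Qed.

(** A Lindelof argument: for every basic open set b contained in the open set of
    some partial lifting, one such lifting is chosen. These basic open sets cover
    M, and they are numbered by [idx]. *)
Lemma countable_partial_liftings : is_transitive A ->
  exists (L : nat -> lifting) (phi : nat -> M -> R) (V : nat -> set M),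
    (forall k, partial_lifting (L k) (phi k) (V k)) /\
    forall x, exists k, V k x.
Proof.
move=> tA; have [B Bcount [_ Bnbhs]] := manifold_second_countable M.
have [idx idx_inj] := countable_injP _ Bcount.
pose good k (D : lifting * (M -> R) * set M) :=
  partial_lifting D.1.1 D.1.2 D.2 /\
  forall b, B b -> idx b = k -> (exists D' : lifting * (M -> R) * set M,
     partial_lifting D'.1.1 D'.1.2 D'.2 /\ b `<=` D'.2) -> b `<=` D.2.
have goodP k : exists D, good k D.
  pose P (D : lifting * (M -> R) * set M) := partial_lifting D.1.1 D.1.2 D.2 /\
    exists b, [/\ B b, idx b = k & b `<=` D.2].
  have [[D [pD [b [Bb bk bD]]]]|nP] := pselect (exists D, P D).
    exists D; split=> // b' Bb' b'k _.
    by rewrite (_ : b' = b) //; apply: idx_inj; rewrite ?inE // bk b'k.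
  (* the zero lifting stands for the numbers that index no suitable basic set *)
  exists ((fun x v => 0), (cst 0), set0); split.
    split=> //; first exact: smooth_lifting0.
      exact: smooth_fun_on_cst.
      exact: open0.
    by move=> y v _; rewrite !scale0r.
  move=> b Bb bk [D [pD bD]]; case: nP; exists D; split=> //; exists b.
  by split.
have [D Dgood] := choice goodP.
exists (fun k => (D k).1.1), (fun k => (D k).1.2), (fun k => (D k).2).
split=> [k|x]; first by have [] := Dgood k.
have [L [phi [V [pL Vx]]]] := partial_lifting_at x tA.
have [b [Bb bx] bV] : exists2 b, B b /\ b x & b `<=` V.
  have [_ _ Vo _ _] := pL.
  have /Bnbhs[b /= [Bb bx] bV] : nbhs x V by exact: open_nbhs_nbhs.
  by exists b.
exists (idx b); have [_ /(_ b Bb erefl)] := Dgood (idx b).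
by apply => //; exists (L, phi, V).
Qed.

(** The functions phi_k r_k, with r_k = (1 - phi_0) ... (1 - phi_(k-1)), form a
    partition of unity: their first n terms add up to 1 - r_n, and r_n vanishes
    for n > j on the open set where phi_j = 1. *)
Fixpoint residue (phi : nat -> M -> R) n : M -> R :=
  if n is k.+1 then residue phi k * (cst 1 + cst (-1) * phi k) else cst 1.

Fixpoint glued_lifting (L : nat -> lifting) (phi : nat -> M -> R) n : lifting :=
  if n is k.+1 then fun x v =>
    glued_lifting L phi k x v + (residue phi k * phi k) x *: L k x v
  else fun x v => 0.

Lemma residueS phi n x : residue phi n.+1 x = residue phi n x * (1 - phi n x).
Proof. by rewrite -[LHS]/(residue phi n x * (1 + -1 * phi n x)) mulN1r. Qed.

Section Glue.
Variables (L : nat -> lifting) (phi : nat -> M -> R) (V : nat -> set M).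
Hypothesis pL : forall k, partial_lifting (L k) (phi k) (V k).
Hypothesis cV : forall x, exists k, V k x.

Lemma smooth_residue n : smooth_fun_on setT (residue phi n).
Proof.
elim: n => [|n IH]; first exact: smooth_fun_on_cst.
have [_ sphi _ _ _] := pL n.
apply: (smooth_fun_onM openT IH); apply: (smooth_fun_onD openT).
  exact: smooth_fun_on_cst.
by apply: (smooth_fun_onM openT) => //; exact: smooth_fun_on_cst.
Qed.

Lemma smooth_glued n : smooth_lifting (glued_lifting L phi n).
Proof.
elim: n => [|n IH]; first exact: smooth_lifting0.
have [sL sphi _ _ _] := pL n.
by apply: smooth_liftingD => //; apply: (smooth_fun_onM openT) => //; exact: smooth_residue.
Qed.

Lemma residue_vanish j n x : V j x -> (j < n)%N -> residue phi n x = 0.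
Proof.
move=> Vx; have [_ _ _ /(_ _ Vx) phi1 _] := pL j.
elim: n => // n IH; rewrite ltnS leq_eqVlt residueS => /orP[/eqP <-|/IH ->].
  by rewrite phi1 subrr mulr0.
by rewrite mul0r.
Qed.

Lemma glued_stable j n x v : V j x -> (j < n)%N ->
  glued_lifting L phi n x v = glued_lifting L phi j.+1 x v.
Proof.
move=> Vx; elim: n => // n IH; rewrite ltnS leq_eqVlt => /orP[/eqP <- //|jn].
rewrite -IH // -[LHS]/(glued_lifting L phi n x v + (residue phi n x * phi n x) *: L n x v).
by rewrite (residue_vanish Vx jn) mul0r scale0r addr0.
Qed.

Lemma anchor_glued n x v : tangent x v ->
  anchor A x (glued_lifting L phi n x v) = (1 - residue phi n x) *: v.
Proof.
move=> tv; elim: n => [|n IH]; first by rewrite linear0 subrr scale0r.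
rewrite -[glued_lifting _ _ _ _ _]/(glued_lifting L phi n x v +
  (residue phi n x * phi n x) *: L n x v).
rewrite linearD IH linearZ -[X in _ + X]/((residue phi n x * phi n x) *: anchor A x (L n x v)).
have [_ _ _ _ /(_ _ _ tv) e] := pL n.
rewrite -[X in _ + X]scalerA e scalerA -scalerDl residueS; congr (_ *: _).
by rewrite mulrBr mulr1 opprB addrA addrAC.
Qed.

(** At x the partial sum is stopped after an index N x for which x lies in
    V (N x). Near x it may be replaced by the partial sum stopped at that fixed
    index, by [glued_stable], so the result is smooth. *)
Lemma glue_partial_liftings : exists Lam : lifting, smooth_lifting Lam /\
  forall x v, tangent x v -> anchor A x (Lam x v) = v.
Proof.
have [N NV] := choice cV.
exists (fun x v => glued_lifting L phi (N x).+1 x v); split; last first.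
  by move=> x v tv; rewrite anchor_glued // (residue_vanish (NV x)) // subr0 scale1r.
split=> [x a u v|tau st]; first exact: (smooth_glued _).1.
apply/asboolP => t i; apply: smooth_fun_on_local => x tx.
have [_ _ Vo _ _] := pL (N x).
exists (triv_dom t `&` V (N x)); first by split.
have /asboolP sx := (smooth_glued (N x).+1).2 _ st.
apply: (eq_smooth_fun_on _ _ (smooth_fun_onS _ (sx t i))).
- by apply: openI => //; exact: triv_dom_open.
- move=> y [ty Vy]; congr (triv t y _ ord0 i).
  rewrite -(glued_stable _ Vy (leq_maxl (N x).+1 (N y).+1)).
  by rewrite -(glued_stable _ (NV y) (leq_maxr (N x).+1 (N y).+1)).
- exact: subIsetl.
Qed.

End Glue.

Lemma anchor_splitting : is_transitive A ->
  exists Lam : lifting, smooth_lifting Lam /\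
  forall x v, tangent x v -> anchor A x (Lam x v) = v.
Proof.
by move=> /countable_partial_liftings[L [phi [V [pL cV]]]]; exact: (glue_partial_liftings pL cV).
Qed.

End Lifts.

(** * Comparison of the cohomology of two complexes *)

Section Comparison.
Variables (R : realType) (V : nat -> lmodType R).
Variables (C C' : forall n, submodClosed (V n)).
Variables (d : forall n, {linear V n -> V n.+1}).
Hypothesis CC' : forall n v, v \in C n -> v \in C' n.
Hypothesis acyclic0 : forall v, v \in C' 0 -> d 0 v \in C 1 -> v \in C 0.
Hypothesis acyclicS : forall n v, v \in C' n.+1 -> d n.+1 v \in C n.+2 ->
  exists2 w, w \in C' n & d n.+1 (d n w) = 0 /\ v - d n w \in C n.+1.

Lemma cocycleP n (z : cocycles C d n) :
  cocycle_val z \in C n /\ d n (cocycle_val z) = 0.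
Proof. by have /andP[? /eqP] := cocycle_proof z. Qed.

Lemma cocycle_incl_subproof n (z : cocycles C d n) :
  is_cocycle C' d (cocycle_val z).
Proof. by have [Cz dz] := cocycleP z; rewrite /is_cocycle CC' // dz eqxx. Qed.

Definition cocycle_incl n (z : cocycles C d n) : cocycles C' d n :=
  Cocycle (cocycle_incl_subproof z).

Lemma cocycle_inclP n a (z z' : cocycles C d n) :
  cocycle_incl (a *: z + z') = a *: cocycle_incl z + cocycle_incl z'.
Proof. exact: val_inj. Qed.

Lemma cocycle_inclB n (z z' : cocycles C d n) :
  cocycle_incl (z - z') = cocycle_incl z - cocycle_incl z'.
Proof. exact: val_inj. Qed.

Lemma coboundary_incl n (z : cocycles C d n) :
  is_coboundary z -> is_coboundary (cocycle_incl z).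
Proof.
case: n z => [|n] z /=; first by move=> /eqP ->; apply/eqP/val_inj.
by move=> /asboolP[w Cw dw]; apply/asboolP; exists w => //; exact: CC'.
Qed.

(** If z = d w with w in C', correcting w by a coboundary d w' puts it in C
    without changing d w. *)
Lemma coboundary_incl_inv n (z : cocycles C d n) :
  is_coboundary (cocycle_incl z) -> is_coboundary z.
Proof.
case: n z => [|n] z /=.
  by move=> /eqP/(congr1 (@cocycle_val _ _ _ _ _)) z0; apply/eqP/val_inj.
move=> /asboolP[w Cw dw]; apply/asboolP.
have Cdw : d n w \in C n.+1 by rewrite dw; have [] := cocycleP z.
case: n => [|n] in z w Cw dw Cdw *; first by exists w => //; exact: acyclic0.
have [w' Cw' [ddw' Cww']] := acyclicS Cw Cdw.
by exists (w - d n w') => //; rewrite linearB /= ddw' subr0.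
Qed.

(** The correction v - d w of a cocycle v is a cocycle of C in the class of v. *)
Lemma cocycle_incl_onto n (z' : cocycles C' d n) :
  exists z : cocycles C d n, is_coboundary (z' - cocycle_incl z).
Proof.
have /andP[Cz /eqP dz] := cocycle_proof z'.
case: n => [|n] in z' Cz dz *.
  have Cz0 : is_cocycle C d (cocycle_val z').
    by rewrite /is_cocycle dz eqxx andbT acyclic0 // dz rpred0.
  exists (Cocycle Cz0); rewrite /= subr_eq0; apply/eqP; exact: val_inj.
have [|w Cw [ddw Czw]] := acyclicS Cz; first by rewrite dz rpred0.
have Cv : is_cocycle C d (cocycle_val z' - d n w).
  by rewrite /is_cocycle Czw linearB /= dz ddw subr0 eqxx.
exists (Cocycle Cv); apply/asboolP; exists w => //.
by rewrite -[RHS]/(cocycle_val z' - (cocycle_val z' - d n w)) subKr.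
Qed.

Lemma cohomology_eqP (D : forall n, submodClosed (V n)) n (z z' : cocycles D d n) :
  \pi_(cohomology D d n) z = \pi z' <-> is_coboundary (z - z').
Proof.
have e : (z - z' \in submod_zmod (coboundaries D d n)) = is_coboundary (z - z') by [].
by rewrite -e Quotient.idealrBE; split=> [->|/eqP].
Qed.

Definition cohomology_map n (x : cohomology C d n) : cohomology C' d n :=
  \pi (cocycle_incl (repr x)).

Lemma cohomology_map_pi n (z : cocycles C d n) :
  cohomology_map (\pi z) = \pi (cocycle_incl z).
Proof.
apply/cohomology_eqP; rewrite -cocycle_inclB; apply: coboundary_incl.
by apply/cohomology_eqP; rewrite reprK.
Qed.

Lemma cohomology_piP (D : forall n, submodClosed (V n)) n a (z z' : cocycles D d n) :
  a *: (\pi z : cohomology D d n) + \pi z' = \pi (a *: z + z').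
Proof.
rewrite -[a *: _]/(lmod_quot_scale a (\pi z)) (pi_lmod_scale _ a z).
exact: pi_lmodD.
Qed.

Lemma cohomology_map_linear n : linear (@cohomology_map n).
Proof.
move=> a x y; rewrite -[x]reprK -[y]reprK.
rewrite (cohomology_piP a (repr x)) !cohomology_map_pi cocycle_inclP.
by rewrite (cohomology_piP a (cocycle_incl (repr x))).
Qed.

(** The hypotheses [acyclic0] and [acyclicS] say that the quotient of the complex
    C' by the subcomplex C is acyclic. *)
Lemma cohomology_iso n :
  exists f : {linear cohomology C d n -> cohomology C' d n}, bijective f.
Proof.
pose fl := GRing.isLinear.Build R _ _ _ _ (@cohomology_map_linear n).
pose f : {linear cohomology C d n -> cohomology C' d n} := HB.pack (@cohomology_map n) fl.
exists f.
have surj y : exists x, f x = y.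
  have [z zE] := cocycle_incl_onto (repr y).
  exists (\pi z); rewrite -[LHS]/(cohomology_map _) cohomology_map_pi -[y]reprK.
  by apply/esym/cohomology_eqP.
have inj : injective f.
  move=> x y; rewrite -[x]reprK -[y]reprK.
  rewrite -[f (\pi (repr x))]/(cohomology_map (\pi (repr x))).
  rewrite -[f (\pi (repr y))]/(cohomology_map (\pi (repr y))).
  rewrite !cohomology_map_pi => /cohomology_eqP; rewrite -cocycle_inclB.
  by move=> /coboundary_incl_inv /cohomology_eqP.
have [g gK] := choice surj.
by exists g => // x; apply: inj; rewrite gK.
Qed.

End Comparison.

(** * Deformation cochains modulo forms with values in the kernel *)

Section Reduction.
Variables (R : realType) (M : manifold R) (A : lie_algebroid M).
Implicit Types (x : M) (n : nat).

Lemma snoc_upd n T (u : 'I_n -> T) (s s' : T) :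
  snoc u s = [eta snoc u s' with ord_max |-> s] :> (_ -> _).
Proof.
apply/funext => i; case: (unliftP ord_max i) => [j|] -> /=.
  by rewrite eq_sym (negbTE (neq_lift _ _)) /snoc liftK.
by rewrite eqxx /snoc unlift_none.
Qed.

Lemma skew_snoc n (D : cochain A n.+1) u s : skew D ->
  D (snoc u s) = (-1) ^+ n *: D (tcons s u).
Proof.
move=> sD; rewrite (snoc_upd u s s) skew_insert //; congr (_ *: D (tcons s _)).
by apply/funext => i; rewrite /= /snoc liftK.
Qed.

Lemma tensor_def_cochain n (D : cochain A n) om :
  tensor_cochain D om -> def_cochain D.
Proof.
move=> tD; split; first exact: tensor_cochain_alternating tD.
case: n D om tD => // n D om /tensor_cochain_tensorial tD.
exists (fun=> 0); first exact: tangent_form0.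
move=> u f v x; rewrite (snoc_upd u _ v) tD -snoc_upd.
by rewrite [X in _ + X *: _](_ : _ = 0) // scale0r addr0.
Qed.

Lemma ad_def_cochain n (D : cochain A n) : ad_cochain D -> def_cochain D.
Proof. by move=> [om [al _ omE]]; apply: (@tensor_def_cochain _ _ om). Qed.

(** By [delta_symbol], a(D u)(f) s = 0 for all sections s and functions f. At a
    point where the fibre of A is not zero, some s does not vanish and a(D u) = 0
    follows; at the other points D u itself is 0. *)
Lemma ad_cochain_of_delta n (D : cochain A n) :
  alternating D -> tensorial D -> ad_cochain (delta D) -> ad_cochain D.
Proof.
move=> aD tD [om' [al' _ om'E]].
have tdD : tensorial (delta D) by apply: (@tensor_cochain_tensorial _ _ _ _ _ om').
have [om [al omE]] := tensorial_tensor_cochain aD tD.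
exists om; split=> // x e.
have [u uE] := choice (fun i => section_through (e i)).
have -> : om x e = D u x by rewrite omE; congr om; apply/funext => i; rewrite uE.
have [[e0 e0n]|triv0] := pselect (exists e0 : A x, e0 != 0); last first.
  have -> : D u x = 0 by apply/eqP/negPn/negP => h; apply: triv0; exists (D u x).
  exact: linear0.
have [s sE] := section_through e0.
apply/funext => f; apply/eqP.
have /eqP : anchor A x (D u x) f *: s x = 0.
  have := delta_symbol u f s x aD tD; rewrite (tensorial_tcons _ _ _ _ tdD).
  by move=> /eqP; rewrite -subr_eq0 opprB addrCA subrr addr0 => /eqP.
by rewrite scaler_eq0 sE (negbTE e0n) orbF.
Qed.

(** With a splitting of the anchor, D' is the lift of the symbol of D with the
    sign that makes the symbols of D and delta D' equal. Then D - delta D' is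
    tensorial, and its coboundary is that of D. *)
Lemma def_acyclicS n (D : cochain A n.+1) : is_transitive A ->
  def_cochain D -> ad_cochain (delta D) ->
  exists2 D' : cochain A n, def_cochain D' &
    delta (delta D') = 0 /\ ad_cochain (D - delta D').
Proof.
move=> tA [aD [sg [al tg sm] sgE]] adD.
have [Lam [[lLam sLam] aLam]] := anchor_splitting tA.
pose D' : cochain A n := fun u =>
  (-1) ^+ n.+1 *: Section (sLam (fun x => sg x (fun i => u i x)) (sm u)).
pose om x (e : 'I_n -> A x) := (-1) ^+ n.+1 *: Lam x (sg x e).
have Lam0 x : Lam x 0 = 0.
  by have := lLam x (-1) 0 0; rewrite scaler0 addr0 scaleN1r addNr.
have tD' : tensor_cochain D' om.
  split=> [x|u x]; last by [].
  split=> [i u a e e'|s u]; rewrite /om.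
    by rewrite (al x).1 lLam scalerDr !scalerA mulrC.
  by rewrite (al x).2 -[_ *: sg x u]addr0 lLam Lam0 addr0 !scalerA mulrC.
have aD' := tensor_cochain_alternating tD'.
have tnD' := tensor_cochain_tensorial tD'.
exists D'; first exact: tensor_def_cochain tD'.
split; first exact: delta_delta.
have adD' := delta_alternating aD'.
have aE : alternating (D - delta D').
  by rewrite addrC -scaleN1r; exact: alternatingP.
apply: ad_cochain_of_delta => //; last first.
  by rewrite deltaB delta_delta // subr0.
apply: tensorialP; first exact: aE.2.
move=> u f s x; rewrite !cochainBE delta_symbol //.
have sD := aD.2.
(* the symbol of D for the first entry instead of the last one *)
have symD : D (tcons (section_scale f s) u) x =
    f x *: D (tcons s u) x + ((-1) ^+ n * sg x (fun i => u i x) f) *: s x.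
  have tc t : D (tcons t u) = (-1) ^+ n *: D (snoc u t).
    by rewrite skew_snoc // scalerA -exprD addnn -signr_odd odd_double scale1r.
  rewrite !tc !section_evalZ sgE scalerDr !scalerA; congr (_ *: _ + _).
  exact: mulrC.
have -> : anchor A x (D' u x) f = - ((-1) ^+ n * sg x (fun i => u i x) f).
  rewrite tD'.2 /om linearZ /= aLam; last exact: tg.
  by rewrite exprS mulN1r scaleNr.
by rewrite symD scaleNr opprK scalerBr opprD addrACA subrr addr0.
Qed.

End Reduction.

Theorem corollary2p2 (R : realType) (M : manifold R) (A : lie_algebroid M)
    (A_transitive : is_transitive A) :
  forall n : nat,
    exists f : {linear ad_cohomology A n -> def_cohomology A n}, bijective f.
Proof.
move=> n.
apply: (@cohomology_iso R (cochain A) (ad_cochains A) (def_cochains A) (@delta R M A)).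
- by move=> k D /asboolP /ad_def_cochain DD; apply/asboolP.
- move=> D /asboolP[aD _] /asboolP adD; apply/asboolP.
  by apply: ad_cochain_of_delta => // -[].
move=> k D /asboolP defD /asboolP adD.
have [D' defD' [ddD' adE]] := def_acyclicS A_transitive defD adD.
by exists D'; [exact/asboolP|split=> //; exact/asboolP].
Qed.
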